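(* Let $d\ge 2$, $t>0$, $c>0$, $a_1,b_1>0$. Conditionally on $\mathcal N(t)=1$, the position $\underline{\mathbf X}_d(t)=c(\underline{\mathbf V}_1\tau_1+\underline{\mathbf V}_2(t-\tau_1))$, where $\tau_1$ has the rescaled Beta density $\frac{\Gamma(a_1+b_1)}{\Gamma(a_1)\Gamma(b_1)}\frac{\tau_1^{a_1-1}(t-\tau_1)^{b_1-1}}{t^{a_1+b_1-1}}$ on $(0,t)$, has probability density function $$\begin{aligned}p_1(\underline{\mathbf x}_d,t)&=\frac{1}{2^{d-2}\pi^{\frac{d+1}{2}}}\frac{\Gamma\left(\frac d2\right)^2}{\Gamma\left(\frac d2-\frac12\right)}\frac{\Gamma(a_1+b_1)}{\Gamma(a_1)\Gamma(b_1)}\frac{1}{t^{a_1+b_1-1}}\frac{(c^2t^2-\|\underline{\mathbf x}_d\|^2)^{\frac{d-3}{2}}}{\|\underline{\mathbf x}_d\|^{d-2}c^{2d-4}}\\&\quad\cdot\int_{\frac t2-\frac{\|\underline{\mathbf x}_d\|}{2c}}^{\frac t2+\frac{\|\underline{\mathbf x}_d\|}{2c}}\tau_1^{a_1-d+1}(t-\tau_1)^{b_1-d+1}\left[4c^2\tau_1(t-\tau_1)-c^2t^2+\|\underline{\mathbf x}_d\|^2\right]^{\frac{d-3}{2}}d\tau_1\end{aligned}$$ for $\underline{\mathbf x}_d\in\mathcal B_{ct}^d$.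
   Context: A particle starts at the origin of $\mathbb R^d$ and moves with constant speed $c>0$; $\mathcal N(t)$ is the number of changes of direction in $[0,t]$. When $\mathcal N(t)=1$ it performs two steps of durations $\tau_1$ and $\tau_2=t-\tau_1$ in directions $\underline{\mathbf V}_1,\underline{\mathbf V}_2$, which are i.i.d. uniformly distributed on the unit sphere of $\mathbb R^d$; directions, $\tau_1$ and $\mathcal N(t)$ are independent. $\mathcal B_{ct}^d=\{x\in\mathbb R^d:\|x\|<ct\}$, with $\|\cdot\|$ the Euclidean norm. A density is determined up to Lebesgue-null sets. *)

(* Defs.v *)
From HB Require Import structures.
From mathcomp Require Import all_boot all_order all_algebra.
From mathcomp Require Import all_classical all_reals all_analysis.

Set Implicit Arguments.
Unset Strict Implicit.
Unset Printing Implicit Defensive.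

Import Order.TTheory GRing.Theory Num.Theory.
Import numFieldNormedType.Exports.

Local Open Scope classical_set_scope.
Local Open Scope ring_scope.

Section lebesgue_cons.
Context (R : realType) (n : nat).
Variable m : {sigma_finite_measure set (n.-tuple R) -> \bar R}.

Let cons_pair (p : measurableTypeR R * n.-tuple R) : n.+1.-tuple R :=
  [tuple of p.1 :: p.2].

Let measurable_cons_pair : measurable_fun [set: _] cons_pair.
Proof. by apply: measurable_cons. Qed.

Definition lebesgue_cons : set (n.+1.-tuple R) -> \bar R :=
  pushforward (lebesgue_measure \x m)%E cons_pair.

Let lebesgue_cons0 : lebesgue_cons set0 = 0%E.
Proof. by rewrite /lebesgue_cons /pushforward preimage_set0 measure0. Qed.

Let lebesgue_cons_ge0 A : (0 <= lebesgue_cons A)%E.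
Proof. exact: measure_ge0. Qed.

Let lebesgue_cons_sigma_additive : semi_sigma_additive lebesgue_cons.
Proof.
move=> F mF tF mUF; rewrite /lebesgue_cons /pushforward preimage_bigcup.
apply: measure_semi_sigma_additive.
- by move=> k; rewrite -[X in measurable X]setTI; exact: measurable_cons_pair.
- apply/trivIsetP => /= i j _ _ ij; rewrite -preimage_setI.
  by move/trivIsetP : tF => /(_ _ _ _ _ ij) ->//; rewrite preimage_set0.
- by rewrite -preimage_bigcup -[X in measurable X]setTI; exact: measurable_cons_pair.
Qed.

HB.instance Definition _ := isMeasure.Build _ _ _ lebesgue_cons
  lebesgue_cons0 lebesgue_cons_ge0 lebesgue_cons_sigma_additive.

Let sigma_finite_lebesgue_cons : sigma_finite setT lebesgue_cons.
Proof.
have /sigma_finiteP[F [TF ndF Foo]] := sigma_finiteT (@lebesgue_measure R).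
have /sigma_finiteP[G [TG ndG Goo]] := sigma_finiteT m.
have mh : measurable_fun [set: n.+1.-tuple R]
    (fun x => thead x : measurableTypeR R).
  exact: (@measurable_tnth _ R n.+1 ord0).
pose tail (x : n.+1.-tuple R) : n.-tuple R := [tuple of behead x].
have mt : measurable_fun setT tail := @measurable_behead _ R n.
exists (fun k => (fun x => thead x) @^-1` F k `&`
                 tail @^-1` G k).
  apply/esym; rewrite -subTset => x _.
  have [i _ Fi] : (\bigcup_k F k) (thead x) by rewrite -TF.
  have [j _ Gj] : (\bigcup_k G k) (tail x) by rewrite -TG.
  exists (maxn i j) => //; split => /=.
    by move: Fi; exact/subsetPset/ndF/leq_maxl.
  by move: Gj; exact/subsetPset/ndG/leq_maxr.
move=> k; have [mFk Fk] := Foo k; have [mGk Gk] := Goo k; split.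
  by apply: measurableI; rewrite -[X in measurable X]setTI; [exact: mh|exact: mt].
rewrite /lebesgue_cons /pushforward [X in product_measure1 _ _ X](_ : _ = F k `*` G k).
  by rewrite product_measure1E// lte_mul_pinfty// ge0_fin_numE.
apply/seteqP; split => -[x y] /=; rewrite theadE (_ : tail _ = y)//;
  exact: val_inj.
Qed.

HB.instance Definition _ := Measure_isSigmaFinite.Build _ _ _ lebesgue_cons
  sigma_finite_lebesgue_cons.

End lebesgue_cons.

(* Lebesgue measure on R^n, seen as n-tuples: iterated product measure along
   R^(n+1) = R x R^n, starting from the unit mass on R^0. *)
Fixpoint lebesgue_tuple (R : realType) (n : nat) :
    {sigma_finite_measure set (n.-tuple R) -> \bar R} :=
  if n is n'.+1 then lebesgue_cons (lebesgue_tuple R n')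
  else \d_[tuple].

Section euclidean.
Context (R : realType) (d : nat).
Implicit Types (x : d.-tuple R) (A : set (d.-tuple R)).

Definition eucl_norm x : R := Num.sqrt (\sum_(i < d) tnth x i ^+ 2).

Definition eucl_ball (r : R) : set (d.-tuple R) := [set x | eucl_norm x < r].

Definition direction x : d.-tuple R := [tuple tnth x i / eucl_norm x | i < d].

(* Uniform distribution on the unit sphere: normalized surface measure, the
   surface measure of A being d times the volume of {s u | 0 < s < 1, u \in A}
   (polar coordinates), so that the factor d cancels in the normalization. *)
Definition sphere_uniform A : \bar R :=
  (fine (lebesgue_tuple R d
      [set x | [/\ 0 < eucl_norm x, eucl_norm x < 1 & A (direction x)]]) /
   fine (lebesgue_tuple R d (eucl_ball 1)))%:E.

End euclidean.

Section probability_notions.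
Context (R : realType).

(* [f] is a version of the density of [nu] with respect to [mu]. *)
Definition has_density (disp : measure_display) (T : measurableType disp)
    (mu : {measure set T -> \bar R}) (nu : set T -> \bar R) (f : T -> R) :=
  [/\ measurable_fun setT f, (forall x, 0 <= f x) &
      forall A, measurable A -> nu A = (\int[mu]_(x in A) (f x)%:E)%E].

Context (disp : measure_display) (Omega : measurableType disp)
  (P : probability Omega R).

Definition sigma_of (disp' : measure_display) (T : measurableType disp')
    (X : {RV P >-> T}) : set (set Omega) :=
  preimage_set_system setT X measurable.

Definition mutually_independent (n : nat) (F : n.-tuple (set (set Omega))) :=
  forall (J : {set 'I_n}) (E : 'I_n -> set Omega),
    (forall i, i \in J -> tnth F i (E i)) ->
    P (\bigcap_(i in [set` J]) E i) = (\prod_(i in J) P (E i))%E.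

Definition conditional_distribution (disp' : measure_display)
    (T : measurableType disp') (X : {RV P >-> T}) (B : set Omega)
    (A : set T) : \bar R :=
  (fine (P (X @^-1` A `&` B)) / fine (P B))%:E.

End probability_notions.

Section densities.
Context (R : realType).
Local Notation leb := (@lebesgue_measure R).

Definition Gamma (a : R) : R :=
  \int[leb]_(x in `]0%R, +oo[) (x `^ (a - 1) * expR (- x)).

Definition rescaled_beta_pdf (t a b : R) (s : R) : R :=
  if s \in `]0, t[ then
    Gamma (a + b) / (Gamma a * Gamma b) *
    (s `^ (a - 1) * (t - s) `^ (b - 1) / t `^ (a + b - 1))
  else 0.

(* The density on the ball of radius c t. At x = 0 (a null set) and, for d = 2,
   at the endpoints of the integration interval, it takes conventional
   values. *)
Definition p1 (d : nat) (c t a b : R) (x : d.-tuple R) : R :=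
  let r := eucl_norm x in
  1 / (2 ^+ (d - 2) * pi `^ ((d%:R + 1) / 2)) *
  (Gamma (d%:R / 2) ^+ 2 / Gamma (d%:R / 2 - 1 / 2)) *
  (Gamma (a + b) / (Gamma a * Gamma b)) *
  (1 / t `^ (a + b - 1)) *
  ((c ^+ 2 * t ^+ 2 - r ^+ 2) `^ ((d%:R - 3) / 2) /
   (r ^+ (d - 2) * c ^+ (2 * d - 4))) *
  \int[leb]_(s in `[t / 2 - r / (2 * c), t / 2 + r / (2 * c)])
    (s `^ (a - d%:R + 1) * (t - s) `^ (b - d%:R + 1) *
     (4 * c ^+ 2 * s * (t - s) - c ^+ 2 * t ^+ 2 + r ^+ 2)
       `^ ((d%:R - 3) / 2)).

End densities.

(* Main.v *)
Require Import Defs.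
From HB Require Import structures.
From mathcomp Require Import all_boot all_order all_algebra.
From mathcomp Require Import all_classical all_reals all_analysis.
From mathcomp Require Import measurable_realfun.
From mathcomp Require Import ring lra.
Set Implicit Arguments.
Unset Strict Implicit.
Unset Printing Implicit Defensive.
Import Order.TTheory GRing.Theory Num.Theory.
Import numFieldNormedType.Exports.
Local Open Scope classical_set_scope.
Local Open Scope ring_scope.

(* By independence, conditioning on N = 1 leaves the joint law of (V1, V2, tau1)
   unchanged. A uniform direction is w / |w| for w uniform in the unit ball, so
   the law of X is an integral over two points w1, w2 of the ball and the
   duration s. With rho = (t - s) / s one has X = c s (V1 + rho V2), and
   y = rho V2 is a point of R^d in polar coordinates. Translating y by - V1 and
   exchanging the integrals makes x = V1 + y the outer variable and leaves the
   inner integral, over V1, of a function of |x - V1|. The distance between x and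
   a uniform point of the sphere has an explicit density: by invariance under
   reflections x may be put on the first axis, the first coordinate u of a uniform
   direction has density proportional to (1 - u^2)^((d-3)/2), and the law of
   cosines relates u to the distance. Going back from rho to s gives p1, the
   triangle inequalities becoming the bounds of its integral; the constants agree
   by the formula for the volume of the unit ball. *)

(** * Image measures and product laws *)

(** No surface measure occurs: an integral over the sphere is an integral over the punctured unit
    ball of a function of [direction], and the dimension is n.+2 throughout. Dividing by the
    duration of the first step gives that step length 1, so that the second vector can range over
    the whole space with Lebesgue measure, where translations act. The prefactor c t / (1 + rho)
    survives the translation and varies with rho; it is removed by a dilation of x at fixed rho,
    which needs one more exchange of integrals. All integrands are nonnegative with values in
    [\bar R], so Tonelli's theorem justifies every exchange without a bound. The price is that the
    density first appears as an extended real, whereas [p1] takes [fine] of its integral. Estimates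
    would have to handle the endpoint singularities for d = 2; instead, the density is finite almost
    everywhere because its total mass is finite. *)

Section weighted_image.
Local Open Scope ereal_scope.
Context d d' (T : measurableType d) (T' : measurableType d') (R : realType).
Variables (mu : {measure set T -> \bar R}) (phi : T -> T') (g : T -> R).
Hypotheses (mphi : measurable_fun setT phi) (mg : measurable_fun setT g).
Hypothesis g0 : forall x, (0 <= g x)%R.

Let wimage (A : set T') : \bar R := \int[mu]_(x in phi @^-1` A) (g x)%:E.

Let mpre A : measurable A -> measurable (phi @^-1` A).
Proof. by move=> mA; rewrite -[_ @^-1` _]setTI; exact: mphi. Qed.

Let wimage0 : wimage set0 = 0.
Proof. by rewrite /wimage preimage_set0 integral_set0. Qed.

Let wimage_ge0 A : 0 <= wimage A.
Proof. by apply: integral_ge0 => x _; rewrite lee_fin. Qed.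

Let wimage_sigma_additive : semi_sigma_additive wimage.
Proof.
move=> F mF tF mUF; rewrite /wimage preimage_bigcup.
apply: (@semi_sigma_additive_nng_induced _ _ _ mu (EFin \o g)).
- exact/measurable_EFinP.
- by move=> x; rewrite lee_fin.
- by move=> n; exact: mpre.
- apply/trivIsetP => /= i j _ _ ij; rewrite -preimage_setI.
  by move/trivIsetP : tF => /(_ _ _ _ _ ij) ->//; rewrite preimage_set0.
- by rewrite -preimage_bigcup; exact: mpre.
Qed.

HB.instance Definition _ := isMeasure.Build _ _ _ wimage
  wimage0 wimage_ge0 wimage_sigma_additive.

Lemma weighted_image_measure : exists nu : {measure set T' -> \bar R},
  forall A, nu A = \int[mu]_(x in phi @^-1` A) (g x)%:E.
Proof. by exists wimage. Qed.

Variable nu : {measure set T' -> \bar R}.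
Hypothesis nuE : forall A, measurable A ->
  nu A = \int[mu]_(x in phi @^-1` A) (g x)%:E.

Import HBNNSimple.

(** Holds on indicators by [nuE], on simple functions by additivity, and on [f] by monotone
    convergence. Only the values of [nu] enter, so the lemma serves image measures ([g] = 1),
    densities ([phi] the identity) and the uniform law on the sphere ([phi] = [direction]). *)
Lemma integral_weighted_image (f : T' -> \bar R) : measurable_fun setT f ->
  (forall x, 0 <= f x) ->
  \int[nu]_y f y = \int[mu]_x (f (phi x) * (g x)%:E).
Proof.
move=> mf f0; pose h := nnsfun_approx measurableT mf.
have cvh x : (h n x)%:E @[n --> \oo] --> f x.
  by apply: cvg_nnsfun_approx => // *; exact: f0.
have ndh x : nondecreasing_seq (fun n => (h n x)%:E).
  by move=> m n mn; rewrite lee_fin; exact/lefP/nd_nnsfun_approx.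
have mgE : measurable_fun setT (EFin \o g) by exact/measurable_EFinP.
have mhphi n : measurable_fun setT (fun x => (h n (phi x))%:E).
  by apply/measurable_EFinP; exact: (measurableT_comp _ mphi).
have -> : \int[nu]_x f x = limn (fun n => \int[nu]_x (h n x)%:E).
  rewrite -monotone_convergence//.
  - by apply: eq_integral => x _; apply/esym/cvg_lim.
  - by move=> n; exact/measurable_EFinP.
  - by move=> n x _; rewrite lee_fin.
have -> : \int[mu]_x (f (phi x) * (g x)%:E) =
    limn (fun n => \int[mu]_x ((h n (phi x))%:E * (g x)%:E)).
  rewrite -monotone_convergence//.
  - apply: eq_integral => x _; apply/esym/cvg_lim => //.
    by apply: cvgeZr; last exact: cvh.
  - by move=> n; exact: emeasurable_funM.
  - by move=> n x _; rewrite mule_ge0// lee_fin.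
  - by move=> x _ m n mn; rewrite lee_wpmul2r ?lee_fin//; exact/ndh.
congr (limn _); apply/funext => n.
under eq_integral do rewrite fimfunE -fsumEFin//.
rewrite ge0_integral_fsum//; last 2 first.
  - by move=> y; apply/measurable_EFinP/measurable_funM.
  - by move=> y x _; rewrite nnfun_muleindic_ge0.
have mi r : measurable_fun setT (fun x => \1_(h n @^-1` [set r]) (phi x) : R).
  exact: (measurableT_comp _ mphi).
transitivity (\int[mu]_x (\sum_(y \in range (h n))
    (y * \1_(h n @^-1` [set y]) (phi x))%:E * (g x)%:E)).
  rewrite ge0_integral_fsum//; last 2 first.
  - move=> y; apply: emeasurable_funM => //.
    by apply/measurable_EFinP/measurable_funM.
  - move=> y x _; apply: mule_ge0; rewrite ?lee_fin//.
    by rewrite -lee_fin nnfun_muleindic_ge0.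
  apply: eq_fsbigr => r rhn.
  rewrite integralZl_indic_nnsfun//.
  under [RHS]eq_integral do rewrite EFinM -muleA.
  have r0 : (0 <= r)%R by move: rhn => /set_mem[x _ <-].
  rewrite [RHS]ge0_integralZl//; last 2 first.
  - by apply: emeasurable_funM => //; exact/measurable_EFinP.
  - by move=> x _; rewrite mule_ge0// lee_fin.
  congr (_ * _); rewrite integral_indic// setIT nuE// integral_mkcond.
  apply: eq_integral => x _; rewrite patchE indicE.
  have -> : (x \in phi @^-1` (h n @^-1` [set r])) = (phi x \in h n @^-1` [set r]).
    by apply/idP/idP => /set_mem ?; apply/mem_set.
  by case: ifPn => _; rewrite ?mul1e ?mul0e.
apply: eq_integral => x _; rewrite -ge0_mule_fsuml; last first.
  by move=> y; exact: nnfun_muleindic_ge0.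
by rewrite fsumEFin// -fimfunE.
Qed.
End weighted_image.

Section product_law.
Local Open Scope ereal_scope.
Context d d1 d2 (T : measurableType d) (T1 : measurableType d1)
  (T2 : measurableType d2) (R : realType).
Variables (m : {measure set T -> \bar R})
  (m1 : {sigma_finite_measure set T1 -> \bar R})
  (m2 : {sigma_finite_measure set T2 -> \bar R}) (k : R).
Variables (X : T -> T1) (Y : T -> T2).
Hypotheses (mX : measurable_fun setT X) (mY : measurable_fun setT Y).
Hypothesis k0 : (0 <= k)%R.
Hypothesis mXY : forall A B, measurable A -> measurable B ->
  m (X @^-1` A `&` Y @^-1` B) = k%:E * (m1 A * m2 B).

(** Meant for [m] a probability restricted to an event of probability [k]: independence on
    rectangles extends to all measurable sets of the product. Dividing by [k] reduces this to the
    uniqueness of the product measure; for [k] = 0 the whole space is null for [m]. *)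
Lemma product_law C : measurable C ->
  m [set w | C (X w, Y w)] = k%:E * (m1 \x m2) C.
Proof.
move=> mC; pose Z w := (X w, Y w).
have mZ : measurable_fun setT Z by exact: measurable_fun_pair.
have mpre A : measurable A -> measurable (Z @^-1` A).
  by move=> mA; rewrite -[_ @^-1` _]setTI; exact: mZ.
have [k00|k_neq0] := eqVneq k 0%R.
  rewrite k00 mul0e; apply: (@subset_measure0 _ _ _ m _ setT) => //.
    exact: mpre.
  by have := mXY measurableT measurableT; rewrite k00 mul0e setIT.
have kV0 : (0 <= k^-1)%R by rewrite invr_ge0.
have [m' m'E] := @weighted_image_measure _ _ _ _ _ m _ _ mZ (measurable_cst (k^-1)%R)
  (fun=> kV0).
have {}m'E A : measurable A -> m' A = (k^-1)%:E * m (Z @^-1` A).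
  move=> mA; rewrite m'E -[LHS]/(\int[m]_(x in Z @^-1` A) cst (k^-1)%:E x).
  by rewrite integral_cst//; exact: mpre.
rewrite (@product_measure_unique _ _ _ _ _ m1 m2 m')//.
  by rewrite m'E// muleA -EFinM divff// mul1e.
move=> A B mA mB; rewrite m'E; last exact: measurableX.
by rewrite [X in m X](_ : _ = X @^-1` A `&` Y @^-1` B)// mXY// muleA -EFinM mulVf// mul1e.
Qed.
End product_law.

(** * Substitution in Lebesgue integrals *)

Section exhaustion.
Context (R : realType).

(** Substitution is proved on segments, where the fundamental theorem of calculus applies; monotone
    convergence along such a union carries it to open or unbounded intervals, at whose ends the
    derivative may blow up. *)
Definition segment_exhausted (D : set R) := exists p q : nat -> R,
  nondecreasing_seq (fun n => `[p n, q n]%classic) /\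
  D = \bigcup_n `[p n, q n]%classic.

Let inv_lt (e : R) : 0 < e -> exists n : nat, n.+1%:R^-1 < e.
Proof.
move=> e0; exists (Num.bound e^-1).
rewrite invf_plt ?posrE//.
have /archi_boundP/lt_le_trans : 0 <= e^-1 by rewrite invr_ge0 ltW.
by apply; rewrite ler_nat.
Qed.

Let inv_le (m n : nat) : (m <= n)%N -> n.+1%:R^-1 <= m.+1%:R^-1 :> R.
Proof. by move=> mn; rewrite lef_pV2 ?posrE ?ltr0n// ler_nat. Qed.

Lemma segment_exhausted_oo (a b : R) : segment_exhausted `]a, b[.
Proof.
exists (fun n => a + n.+1%:R^-1), (fun n => b - n.+1%:R^-1); split.
  move=> m n mn; apply/subsetPset; apply: subset_itv; rewrite bnd_simp.
    by rewrite lerD2l inv_le.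
  by rewrite lerD2l lerN2 inv_le.
apply/seteqP; split => x/=; rewrite in_itv/=.
  move=> /andP[ax xb].
  have /inv_lt[n] : 0 < Num.min (x - a) (b - x) by rewrite lt_min !subr_gt0 ax.
  rewrite lt_min => /andP[nx nb]; exists n => //=; rewrite in_itv/=.
  by rewrite -lerBrDl ltW//= lerBrDl -lerBrDr ltW.
move=> [n _]; rewrite /= in_itv/= => /andP[nx xn].
have n0 : 0 < n.+1%:R^-1 :> R by rewrite invr_gt0 ltr0n.
by rewrite (lt_le_trans _ nx) ?ltrDl//= (le_lt_trans xn)// gtrDl oppr_lt0.
Qed.

Lemma segment_exhausted_oy (a : R) : segment_exhausted `]a, +oo[.
Proof.
exists (fun n => a + n.+1%:R^-1), (fun n => a + n%:R); split.
  move=> m n mn; apply/subsetPset; apply: subset_itv; rewrite bnd_simp.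
    by rewrite lerD2l inv_le.
  by rewrite lerD2l ler_nat.
apply/seteqP; split => x/=; rewrite in_itv/= andbT.
  move=> ax; have /inv_lt[n nx] : 0 < x - a by rewrite subr_gt0.
  have /archi_boundP : 0 <= x - a by rewrite subr_ge0 ltW.
  set m := Num.bound _ => xm.
  exists (maxn n m) => //=; rewrite in_itv/=; apply/andP; split.
    by rewrite -lerBrDl (le_trans _ (ltW nx))// inv_le// leq_maxl.
  by rewrite -lerBlDl (le_trans (ltW xm))// ler_nat leq_maxr.
move=> [n _]; rewrite /= in_itv/= => /andP[nx xn].
by rewrite (lt_le_trans _ nx)// ltrDl invr_gt0 ltr0n.
Qed.

End exhaustion.

Section substitution.
Local Open Scope ereal_scope.
Context (R : realType).
Local Notation leb := (@lebesgue_measure R).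
Variables (F f : R -> R).
Hypotheses (mF : measurable_fun setT F) (mf : measurable_fun setT f).

Section compact.
Variables (p q : R).
Hypothesis Ff : forall x, x \in `[p, q]%R -> is_derive x (1%R : R) F (f x).
Hypothesis cf : forall x, x \in `[p, q]%R -> {for x, continuous f}.
Hypothesis f0 : forall x, x \in `[p, q]%R -> (0 < f x)%R.

Let cF : {within `[p, q], continuous F}.
Proof. by apply: derivable_within_continuous => x /Ff[]. Qed.

Let incrF : {in `[p, q]%R &, {homo F : x y / (x < y)%R}}.
Proof.
apply: gtr0_derive1_lt_cc => [x|x|//] /subset_itv_oo_cc xpq.
  by have [] := Ff xpq.
by rewrite derive1E; have [_ ->] := Ff xpq; exact: f0.
Qed.

Let incrFle : {in `[p, q]%R &, {mono F : x y / (x <= y)%R}}.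
Proof. exact: le_mono_in. Qed.

Let image_cc x y : (p <= x)%R -> (x <= y)%R -> (y <= q)%R ->
  F @` `[x, y] = `[F x, F y]%classic.
Proof.
move=> px xy yq.
have xin : x \in `[p, q]%R by rewrite in_itv/= px (le_trans xy).
have yin : y \in `[p, q]%R by rewrite in_itv/= yq (le_trans px).
apply/seteqP; split => [_ [z/= + <-]|z/=]; rewrite !in_itv/=.
  move=> /andP[xz zy]; have zin : z \in `[p, q]%R.
    by rewrite in_itv/= (le_trans px)//= (le_trans zy).
  by rewrite !incrFle// xz zy.
move=> /andP[xz zy].
have [||c cxy Fc] := @IVT R F x y z xy.
- by apply: continuous_subspaceW cF; apply: subset_itv; rewrite bnd_simp.
- by rewrite ge_min le_max xz zy orbT.
- by exists c.
Qed.

Lemma measurable_image_cc : measurable (F @` `[p, q]).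
Proof.
have [pq|qp] := leP p q; first by rewrite image_cc.
by rewrite set_itv_ge ?image_set0// bnd_simp -ltNge.
Qed.

Let integral_f x y : (p <= x)%R -> (x <= y)%R -> (y <= q)%R ->
  \int[leb]_(z in `[x, y]) (f z)%:E = (F y - F x)%:E.
Proof.
move=> px; rewrite le_eqVlt => /predU1P[<-|xy] yq.
  by rewrite set_itv1 integral_set1 subrr.
have sub z : z \in `[x, y]%R -> z \in `[p, q]%R.
  by apply: subset_itv; rewrite bnd_simp.
rewrite (@continuous_FTC2 _ f F)//.
- by apply: continuous_in_subspaceT => z /set_mem/= /sub; exact: cf.
- have cFz z : z \in `[x, y]%R -> {for z, continuous F}.
    move=> /sub/Ff[dF _].
    by apply: differentiable_continuous; apply/derivable1_diffP.
  split.
  + by move=> z /subset_itv_oo_cc/sub/Ff[].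
  + by apply: cvg_at_right_filter; apply: cFz; rewrite in_itv/= lexx ltW.
  + by apply: cvg_at_left_filter; apply: cFz; rewrite in_itv/= lexx ltW.
- by move=> z /subset_itv_oo_cc/sub/Ff[_]; rewrite derive1E.
Qed.

(** The image under [F] of the measure f dx on the segment is Lebesgue measure on the image of the
    segment: the two finite measures agree on the rays [x, +oo[, where the identity is the
    fundamental theorem of calculus, and these rays generate the Borel sets. *)
Lemma substitution_cc (H : R -> \bar R) : measurable_fun setT H ->
  (forall y, 0 <= H y) ->
  \int[leb]_(y in F @` `[p, q]) H y = \int[leb]_(x in `[p, q]) (H (F x) * (f x)%:E).
Proof.
move=> mH H0; have [qp|pq] := ltP q p.
  by rewrite set_itv_ge ?image_set0 ?integral_set0// bnd_simp -ltNge.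
pose g := (f \_ `[p, q])%R.
have mg : measurable_fun setT g.
  by apply: (measurable_restrictT f _).1 => //; exact: measurable_funTS.
have g0 x : (0 <= g x)%R.
  by rewrite /g patchE; case: ifPn => // /set_mem/f0/ltW.
have [nu nuE] := @weighted_image_measure _ _ _ (measurableTypeR R) _ leb F g mF mg g0.
have nuI A : nu A = \int[leb]_(x in F @^-1` A `&` `[p, q]) (f x)%:E.
  rewrite nuE integral_mkcondr; apply: eq_integral => x _.
  by rewrite /g !patchE; case: ifPn.
have nuJ A : measurable A -> nu A = leb (A `&` F @` `[p, q]).
  move: A; refine (@measure_unique _ R (measurableTypeR R) (@RGenCInfty.G R)
    (fun k : nat => `[(- k%:R)%R, +oo[%classic) _ _ _ _ nu
    (mrestr leb measurable_image_cc) _ _).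
  - exact: RGenCInfty.measurableE.
  - move=> _ _ [x ->] [y ->]; exists (Num.max x y).
    apply/seteqP; split => z/=; rewrite !in_itv/= !andbT ge_max.
      by move=> [-> ->].
    by move=> /andP[].
  - by move=> k; exists (- k%:R)%R.
  - rewrite -subTset => x _; exists (Num.bound `|x|%R) => //=.
    rewrite in_itv/= andbT lerNl (le_trans (ler_norm _))// normrN.
    exact/ltW/archi_boundP.
  - move=> _ [x ->]; rewrite nuI /= /mrestr/= image_cc//.
    have pin : p \in `[p, q]%R by rewrite in_itv/= lexx.
    have qin : q \in `[p, q]%R by rewrite in_itv/= lexx andbT.
    have [Fqx|xFq] := ltP (F q) x.
      rewrite [X in \int[_]_(x in X) _](_ : _ = set0) ?integral_set0; last first.
        rewrite -subset0 => z/= []; rewrite !in_itv/= andbT => xFz /andP[pz zq].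
        move: xFz; rewrite leNgt (le_lt_trans _ Fqx)// incrFle//.
        by rewrite in_itv/= pz.
      rewrite (_ : _ `&` _ = set0) ?measure0//.
      rewrite -subset0 => z/= []; rewrite !in_itv/= andbT => xz /andP[_].
      by move=> /(le_trans xz); rewrite leNgt Fqx.
    (* The ray meets [F p, F q] from [x'] on; the preimage [z] of [x'], given by the intermediate
       value theorem, turns the condition x <= F y into z <= y. *)
    pose x' := Num.max (F p) x.
    have [z zpq Fz] : (F @` `[p, q]) x'.
      rewrite image_cc//= in_itv/= /x' le_max lexx/= ge_max xFq andbT.
      by rewrite incrFle.
    have /andP[pz zq] : (p <= z <= q)%R by move: zpq; rewrite /= in_itv/=.
    rewrite [X in \int[_]_(x in X) _](_ : _ = `[z, q]%classic); last first.
      apply/seteqP; split => y/=; rewrite !in_itv/= !andbT.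
        move=> [xFy /andP[py yq]]; rewrite yq andbT -incrFle ?in_itv/= ?py//.
        by rewrite Fz /x' ge_max xFy incrFle// ?in_itv/= ?py.
      move=> /andP[zy yq]; have py := le_trans pz zy.
      split; last by rewrite py.
      have : (F z <= F y)%R by rewrite incrFle// in_itv/= py.
      by rewrite Fz /x' ge_max => /andP[].
    rewrite integral_f// (_ : _ `&` _ = `[x', F q]%classic); last first.
      apply/seteqP; split => y/=; rewrite !in_itv/= !andbT.
        by move=> [xy /andP[Fpy ->]]; rewrite /x' ge_max Fpy xy.
      by rewrite /x' ge_max => /andP[/andP[-> ->] ->].
    have x'q : (x' <= F q)%R by rewrite /x' ge_max xFq andbT incrFle.
    rewrite lebesgue_measure_itv/= lte_fin Fz; case: ltgtP => //.
    + by rewrite ltNge x'q.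
    + by move=> ->; rewrite subrr.
  - move=> k; rewrite (@le_lt_trans _ _ (nu setT)) ?le_measure ?inE//.
    by rewrite nuI preimage_setT setTI integral_f// ltry.
rewrite (@eq_measure_integral _ _ _ _ nu); last first.
  by move=> A mA AJ; rewrite nuJ// setIidl.
rewrite integral_mkcond (@integral_weighted_image _ _ _ (measurableTypeR R) _
  leb F g mF mg g0 nu)//; last 2 first.
- apply: (measurable_restrictT H _).1; first exact: measurable_image_cc.
  exact: measurable_funTS.
- by move=> y; rewrite patchE; case: ifPn.
rewrite [RHS]integral_mkcond; apply: eq_integral => x _.
rewrite /g !patchE; have [xpq|xpq] := boolP (x \in `[p, q]%classic); last first.
  by rewrite mule0.
rewrite ifT//; apply/mem_set; exists x => //; exact/set_mem.
Qed.
End compact.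

Lemma increasing_substitution (D : set R) (H : R -> \bar R) :
  segment_exhausted D ->
  (forall x, D x -> is_derive x (1%R : R) F (f x)) ->
  (forall x, D x -> {for x, continuous f}) ->
  (forall x, D x -> (0 < f x)%R) ->
  measurable_fun setT H -> (forall y, 0 <= H y) ->
  \int[leb]_(y in F @` D) H y = \int[leb]_(x in D) (H (F x) * (f x)%:E).
Proof.
move=> [p [q [ndpq DE]]] Ff cf f0 mH H0.
have inD n x : x \in `[p n, q n]%R -> D x by rewrite DE; exists n.
have mD n : measurable (F @` `[p n, q n]).
  apply: measurable_image_cc => x /inD.
  + exact: Ff.
  + exact: f0.
have -> : F @` D = \bigcup_n (F @` `[p n, q n]) by rewrite DE image_bigcup.
have c1 : \int[leb]_(y in F @` `[p n, q n]) H y @[n --> \oo] -->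
    \int[leb]_(y in \bigcup_n (F @` `[p n, q n])) H y.
  apply: ge0_nondecreasing_set_cvg_integral => //.
  - by move=> m n mn; apply/subsetPset/image_subset; exact/subsetPset/ndpq.
  - by move=> n; exact: measurable_funTS.
rewrite (_ : (fun n => _) = (fun n => \int[leb]_(x in `[p n, q n])
    (H (F x) * (f x)%:E))) in c1; last first.
  apply/funext => n; apply: substitution_cc => // x /inD.
  + exact: Ff.
  + exact: cf.
  + exact: f0.
apply: (cvg_unique _ c1); first exact: ereal_hausdorff.
rewrite DE; apply: ge0_nondecreasing_set_cvg_integral => //.
- move=> n; apply: measurable_funTS.
  by apply: emeasurable_funM; [exact: (measurableT_comp mH mF)|exact/measurable_EFinP].
- by move=> n x nx; rewrite mule_ge0// lee_fin ltW// f0// DE; exists n.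
Qed.

End substitution.

Section decreasing_substitution.
Local Open Scope ereal_scope.
Context (R : realType).
Local Notation leb := (@lebesgue_measure R).
Variables (F f : R -> R).
Hypotheses (mF : measurable_fun setT F) (mf : measurable_fun setT f).

(** The increasing case for - F, followed by the invariance of Lebesgue measure under y -> - y. *)
Lemma decreasing_substitution (D : set R) (H : R -> \bar R) :
  segment_exhausted D ->
  (forall x, D x -> is_derive x (1%R : R) F (- f x)%R) ->
  (forall x, D x -> {for x, continuous f}) ->
  (forall x, D x -> (0 < f x)%R) ->
  measurable_fun setT H -> (forall y, 0 <= H y) ->
  measurable (F @` D) ->
  \int[leb]_(y in F @` D) H y = \int[leb]_(x in D) (H (F x) * (f x)%:E).
Proof.
move=> eD Ff cf f0 mH H0 mFD.
pose F' x := (- F x)%R.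
have mF' : measurable_fun setT F' by exact: measurableT_comp.
have Ff' x : D x -> is_derive x (1%R : R) F' (f x).
  by move=> /Ff dF; rewrite -[f x]opprK; exact: is_deriveN.
have mHN : measurable_fun setT (fun y : R => H (- y)%R) by exact: measurableT_comp.
have := @increasing_substitution R F' f mF' mf D (fun y : R => H (- y)%R) eD Ff' cf f0
  mHN (fun=> H0 _).
rewrite /F'; under [in RHS]eq_integral do rewrite opprK.
move=> <-; rewrite integral_mkcond [RHS]integral_mkcond.
have mN : measurable_fun setT (-%R : R -> R) by exact: oppr_measurable.
rewrite (@integral_weighted_image _ _ _ (measurableTypeR R) _ leb (-%R) (cst 1%R)
  mN (measurable_cst _) (fun=> ler01) leb)//; last first.
- by move=> y; rewrite patchE; case: ifPn.
- by apply: (measurable_restrictT H _).1 => //; exact: measurable_funTS.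
- move=> A mA; rewrite -[LHS](lebesgue_measureN mA) -[RHS]/(\int[leb]_(x in -%R @^-1` A) cst 1 x).
  by rewrite integral_cst ?mul1e// -[X in measurable X]setTI; exact: mN.
apply: eq_integral => y _; rewrite mule1 !patchE.
rewrite (_ : (- y \in F @` D)%R = (y \in [set - F x | x in D]%R))//.
apply/idP/idP => /set_mem[x Dx]; first by move=> Fy; apply/mem_set; exists x; rewrite // Fy opprK.
by move=> <-; apply/mem_set; exists x => //; rewrite opprK.
Qed.
End decreasing_substitution.

(** * Lebesgue measure on tuples *)

Section measurability.
Context d (T : measurableType d) (R : realType).

Lemma measurable_funV (f : T -> R) : measurable_fun setT f ->
  measurable_fun setT (fun x => (f x)^-1).
Proof.
(* The power of exponent - 1 is the inverse on nonnegative reals, hence the square; where [f]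
   vanishes both sides are 0, the conventional inverse. *)
move=> mf; rewrite (_ : (fun x => _) = (fun x => f x * (f x ^+ 2) `^ (-1))).
  apply: measurable_funM => //; apply: (measurableT_comp (measurable_powR _)).
  exact: measurable_funX.
apply/funext => x; rewrite powR_inv1 ?sqr_ge0//.
have [->|fx0] := eqVneq (f x) 0; first by rewrite invr0 mul0r.
by rewrite expr2 invfM mulrA divff// mul1r.
Qed.

Lemma measurable_fun_natb (b : T -> bool) : measurable_fun setT b ->
  measurable_fun setT (fun x => (b x)%:R : R).
Proof.
move=> mb; rewrite (_ : (fun x => _) = (fun x => if b x then 1 else 0 : R)).
  by apply: measurable_fun_ifT.
by apply/funext => x; case: (b x).
Qed.

Lemma measurable_sqrt (f : T -> R) : measurable_fun setT f ->
  measurable_fun setT (fun x => Num.sqrt (f x)).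
Proof.
move=> mf; have ms : measurable_fun setT (@Num.sqrt R).
  by apply: continuous_measurable_fun; exact: sqrt_continuous.
exact: (measurableT_comp ms).
Qed.

Lemma measurable_eucl_norm n (f : T -> n.-tuple R) : measurable_fun setT f ->
  measurable_fun setT (fun x => eucl_norm (f x)).
Proof.
move=> mf; apply: measurable_sqrt.
apply: measurable_sum => i; apply: measurable_funX.
exact: (measurableT_comp (measurable_tnth i) mf).
Qed.

Lemma measurable_tnth_comp n (f : T -> n.-tuple R) i : measurable_fun setT f ->
  measurable_fun setT (fun x => tnth (f x) i).
Proof. exact: (measurableT_comp (measurable_tnth i)). Qed.

Lemma measurable_mktuple n (f : T -> 'I_n -> R) :
  (forall i, measurable_fun setT (f ^~ i)) ->
  measurable_fun setT (fun x => [tuple f x i | i < n]).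
Proof.
move=> mf; apply/measurable_fun_tnthP => i.
rewrite (_ : _ \o _ = f ^~ i)//.
by apply/funext => x /=; rewrite tnth_mktuple.
Qed.

Lemma measurable_tuple_cons n (f : T -> R) (g : T -> n.-tuple R) :
  measurable_fun setT f -> measurable_fun setT g ->
  measurable_fun setT (fun x => [tuple of f x :: g x]).
Proof. exact: measurable_cons. Qed.

End measurability.

Ltac mfun := repeat (first
  [ exact: measurable_cst | exact: measurable_id | exact: measurable_fst
  | exact: measurable_snd | assumption
  | apply: measurable_funV | apply: measurable_funX
  | apply: measurable_funM | apply: measurable_funD | apply: measurable_funB
  | apply: measurable_funN | apply: measurable_eucl_norm
  | apply: measurable_sqrt
  | apply: (measurableT_comp (measurable_powR _))
  | apply: (measurableT_comp (@measurable_expR _))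
  | apply: measurable_mktuple => ? | apply: measurable_tuple_cons
  | apply: measurable_tnth_comp | apply: measurable_fun_natb
  | apply: measurable_fun_ltr | apply: measurable_fun_ler
  | apply: measurable_and
  | (apply: measurableT_comp; [assumption|]) ]).

Section lebesgue_tuple_theory.
Local Open Scope ereal_scope.
Context (R : realType).
Local Notation leb := (@lebesgue_measure R).
Local Notation lam n := (lebesgue_tuple R n).

Lemma fubini_tonelli_in d1 d2 (T1 : measurableType d1) (T2 : measurableType d2)
    (m1 : {sigma_finite_measure set T1 -> \bar R})
    (m2 : {sigma_finite_measure set T2 -> \bar R}) D1 D2 (f : T1 -> T2 -> \bar R) :
  measurable D1 -> measurable D2 ->
  measurable_fun setT (fun z => f z.1 z.2) -> (forall x y, 0 <= f x y) ->
  \int[m1]_(x in D1) \int[m2]_(y in D2) f x y =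
  \int[m2]_(y in D2) \int[m1]_(x in D1) f x y.
Proof.
move=> mD1 mD2 mf f0; pose g := (fun z => f z.1 z.2) \_ (D1 `*` D2).
have mg : measurable_fun setT g.
  apply: (measurable_restrictT _ _).1; first exact: measurableX.
  exact: measurable_funTS.
have g0 z : 0 <= g z by rewrite /g patchE; case: ifPn.
transitivity (\int[m1]_x \int[m2]_y g (x, y)).
  rewrite integral_mkcond; apply: eq_integral => x _; rewrite patchE.
  case: ifPn => [xD|/negP xD].
    rewrite integral_mkcond; apply: eq_integral => y _; rewrite /g !patchE.
    by rewrite in_setX xD.
  rewrite integral0_eq// => y _; rewrite /g patchE in_setX.
  by rewrite (negbTE (introN idP xD)).
rewrite fubini_tonelli//.
rewrite [RHS]integral_mkcond; apply: eq_integral => y _; rewrite patchE.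
case: ifPn => [yD|/negP yD].
  rewrite [RHS]integral_mkcond; apply: eq_integral => x _; rewrite /g !patchE.
  by rewrite in_setX yD andbT.
rewrite integral0_eq// => x _; rewrite /g patchE in_setX.
by rewrite (negbTE (introN idP yD)) andbF.
Qed.

Lemma integral_cons n (F : n.+1.-tuple R -> \bar R) :
  measurable_fun setT F -> (forall x, 0 <= F x) ->
  \int[lam n.+1]_x F x = \int[leb]_a \int[lam n]_y F [tuple of a :: y].
Proof.
move=> mF F0.
pose cons_pair (p : measurableTypeR R * n.-tuple R) : n.+1.-tuple R :=
  [tuple of p.1 :: p.2].
have mc : measurable_fun setT cons_pair by exact: measurable_cons.
etransitivity; first exact: (ge0_integral_pushforward mc).
by rewrite preimage_setT (fubini_tonelli1 (F \o cons_pair) (measurableT_comp mF mc) (fun=> F0 _)).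
Qed.

Lemma integral_affine (F : R -> \bar R) (k b : R) : (0 < k)%R ->
  measurable_fun setT F -> (forall x, 0 <= F x) ->
  \int[leb]_x F (b + k * x)%R = (k^-1)%:E * \int[leb]_x F x.
Proof.
move=> k0 mF F0; pose phi x := (b + k * x)%R : R.
have mphi : measurable_fun setT phi by mfun.
have e : segment_exhausted [set: R].
  exists (fun n => - n%:R)%R, (fun n => n%:R); split.
    move=> m n mn; apply/subsetPset; apply: subset_itv; rewrite bnd_simp.
      by rewrite lerN2 ler_nat.
    by rewrite ler_nat.
  apply/esym; rewrite -subTset => x _; have /archi_boundP := normr_ge0 x.
  set m := Num.bound _ => /ltW; rewrite ler_norml => xm.
  by exists m => //=; rewrite in_itv.
have dphi x : is_derive x (1%R : R) phi (cst k x).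
  by apply: is_derive_eq; rewrite add0r mul1r; exact: mulr1.
have ck x : {for x, continuous (cst k : R -> R)} by exact: cst_continuous.
have phiT : phi @` setT = setT.
  rewrite -subTset => x _; exists ((x - b) / k)%R => //.
  by rewrite /phi mulrC divfK ?gt_eqF// addrC subrK.
have := @increasing_substitution R phi (cst k) mphi (measurable_cst _) setT F e
  (fun x _ => dphi x) (fun x _ => ck x) (fun _ _ => k0) mF F0.
rewrite phiT => ->.
rewrite /cst/= ge0_integralZr ?lee_fin ?ltW//; last exact: measurableT_comp.
by rewrite muleC -muleA -EFinM divff ?gt_eqF// mule1.
Qed.

Definition tuple_affine n (k : R) (b y : n.-tuple R) : n.-tuple R :=
  [tuple (tnth b i + k * tnth y i)%R | i < n].

Lemma measurable_tuple_affine d (T : measurableType d) n (k : T -> R)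
    (b y : T -> n.-tuple R) :
  measurable_fun setT k -> measurable_fun setT b -> measurable_fun setT y ->
  measurable_fun setT (fun x => tuple_affine (k x) (b x) (y x)).
Proof. by move=> mk mb my; rewrite /tuple_affine; mfun. Qed.

(** One induction on the dimension gives dilations and translations together; [b] is general because
    its tail translates the remaining coordinates. *)
Lemma integral_tuple_affine n (F : n.-tuple R -> \bar R) (k : R) b :
  (0 < k)%R -> measurable_fun setT F -> (forall x, 0 <= F x) ->
  \int[lam n]_x F (tuple_affine k b x) = (k ^- n)%:E * \int[lam n]_x F x.
Proof.
move=> k0; elim: n => [|n IH] in F b *.
  move=> mF F0; rewrite expr0 invr1 mul1e; apply: eq_integral => x _.
  by congr F; rewrite tuple0 [RHS]tuple0.
move=> mF F0; pose b' : n.-tuple R := [tuple of behead b].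
have mFa a : measurable_fun setT (fun y : n.-tuple R => F [tuple of a :: y]).
  by apply: (measurableT_comp mF); mfun.
pose G (a : R) := \int[lam n]_y F [tuple of a :: y].
have mG : measurable_fun setT G.
  apply: (measurable_fun_fubini_tonelli_F
    (fun z : R * n.-tuple R => F [tuple of z.1 :: z.2])) => //.
  by apply: (measurableT_comp mF); mfun.
have G0 a : 0 <= G a by exact: integral_ge0.
have mk : measurable_fun setT (fun y : n.+1.-tuple R => tuple_affine k b y).
  by apply: measurable_tuple_affine; mfun.
rewrite !integral_cons//; last exact: (measurableT_comp mF mk).
under eq_integral => a _.
  under eq_integral => y _.
    rewrite (_ : tuple_affine k b _ =
      [tuple of (thead b + k * a)%R :: tuple_affine k b' y]); last first.
      apply: eq_from_tnth => i; rewrite tnth_mktuple.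
      case: (unliftP ord0 i) => [j|] ->; last by rewrite !tnth0.
      rewrite !tnthS tnth_mktuple /b' tnth_behead (_ : inord _ = lift ord0 j)//.
      by apply/val_inj; rewrite /= inordK ?lift0 ?ltnS.
    over.
  rewrite (IH (fun y => F [tuple of (thead b + k * a)%R :: y]) b' (mFa _) (fun=> F0 _)).
  over.
rewrite /= ge0_integralZl ?lee_fin ?invr_ge0 ?exprn_ge0 ?ltW//; last 2 first.
- have maff : measurable_fun setT (fun a : R => thead b + k * a)%R by mfun.
  exact: (measurableT_comp mG maff).
- by move=> a _; exact: integral_ge0.
rewrite (@integral_affine G)// muleA -EFinM -invfM -exprSr.
by [].
Qed.

End lebesgue_tuple_theory.

(** * Gamma integrals *)

Section one_dimensional.
Local Open Scope ereal_scope.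
Context (R : realType).
Local Notation leb := (@lebesgue_measure R).

(** Turns a domain into a 0/1 factor, so that integrals whose domain depends on the other variable
    can be exchanged over the whole space. *)
Lemma integral_mkbool d (T : measurableType d) (mu : {measure set T -> \bar R})
    (b : T -> bool) (f : T -> \bar R) :
  \int[mu]_(x in [set x | b x]) f x = \int[mu]_x ((b x)%:R%:E * f x).
Proof.
rewrite integral_mkcond; apply: eq_integral => x _; rewrite patchE.
have [bx|bx] := boolP (b x).
  by rewrite mem_set// mul1e.
by rewrite memNset ?mul0e//=; exact/negP.
Qed.

(** The primitive maps the unbounded ray onto a bounded interval, and [decreasing_substitution] with
    [H] = 1 identifies the integral with the length of that interval. *)
Lemma integral_powR_tail (p a : R) : (0 < p)%R -> (0 < a)%R ->
  \int[leb]_(x in `]a, +oo[) (x `^ (- p - 1))%:E = (a `^ (- p) / p)%:E.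
Proof.
move=> p0 a0; pose F (x : R) := (x `^ (- p) / p)%R.
pose f (x : R) := (x `^ (- p - 1))%R.
have mF : measurable_fun setT F by rewrite /F; mfun.
have mf : measurable_fun setT f by rewrite /f; mfun.
have FD : F @` `]a, +oo[ = `]0%R, (a `^ (- p) / p)%R[%classic.
  apply/seteqP; split => [_ [x/= + <-]|y/=]; rewrite !in_itv/=.
    rewrite andbT => ax; have x0 := lt_trans a0 ax.
    rewrite /F divr_gt0 ?powR_gt0//= ltr_pM2r ?invr_gt0//.
    by rewrite !powRN ltf_pV2 ?posrE ?powR_gt0// gt0_ltr_powR ?nnegrE ?ltW.
  move=> /andP[y0 ya]; have py0 : (0 < p * y)%R by rewrite mulr_gt0.
  exists ((p * y) `^ (- p^-1))%R.
    rewrite in_itv/= andbT -[ltLHS](_ : (a `^ (- p)) `^ (- p^-1) = a)%R; last first.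
      by rewrite -powRrM mulrNN divff ?gt_eqF// powRr1// ltW.
    rewrite !(powRN _ p^-1) ltf_pV2 ?posrE ?powR_gt0//.
    rewrite gt0_ltr_powR ?invr_gt0 ?nnegrE ?powR_ge0 ?ltW//.
    by rewrite mulrC -ltr_pdivlMr.
  by rewrite /F -powRrM mulrNN mulVf ?gt_eqF// powRr1 1?ltW// mulrC mulKf ?gt_eqF.
have D0 x : x \in `]a, +oo[%R -> (0 < x)%R.
  by rewrite in_itv/= andbT; exact: lt_trans.
have dF x : x \in `]a, +oo[%R -> is_derive x (1%R : R) F (- f x)%R.
  move=> /D0 x0; have := @is_derive1_powR R (- p)%R x x0 => dx.
  apply: is_derive_eq; rewrite scaler0 add0r -[LHS]/(_ * _)%R.
  by rewrite mulrA mulrN mulVf ?gt_eqF// mulN1r.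
have cf x : x \in `]a, +oo[%R -> {for x, continuous f}.
  move=> /D0 x0; have [dx _] := @is_derive1_powR R (- p - 1)%R x x0.
  by apply: differentiable_continuous; apply/derivable1_diffP.
have f0 x : x \in `]a, +oo[%R -> (0 < f x)%R by move=> /D0; exact: powR_gt0.
have := @decreasing_substitution R F f mF mf `]a, +oo[ (cst 1)
  (segment_exhausted_oy a) dF cf f0 (measurable_cst _) (fun=> lee01).
rewrite FD => /(_ (measurable_itv _)).
rewrite integral_cst//= mul1e lebesgue_measure_itv/= lte_fin.
rewrite divr_gt0 ?powR_gt0// oppr0 adde0 => ->.
by apply: eq_integral => x _; rewrite mul1e.
Qed.

(** The substitution y = x^2; it brings the radial Gaussian integral in dimension n + 1 to Gamma at
    (n + 1) / 2. *)
Lemma Gamma_gauss (n : nat) :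
  \int[leb]_(x in `]0%R, +oo[) (x ^+ n * expR (- x ^+ 2))%:E * 2%:E =
  \int[leb]_(x in `]0%R, +oo[) (x `^ (n.+1%:R / 2 - 1) * expR (- x))%:E.
Proof.
pose F (x : R) := (x ^+ 2)%R; pose f (x : R) := (2 * x)%R.
have mF : measurable_fun setT F by rewrite /F; mfun.
have mf : measurable_fun setT f by rewrite /f; mfun.
have FD : F @` `]0%R, +oo[ = `]0%R, +oo[%classic.
  apply/seteqP; split => [_ [x/= + <-]|y/=]; rewrite !in_itv/= !andbT.
    by move=> x0; rewrite exprn_gt0.
  move=> y0; exists (Num.sqrt y); first by rewrite in_itv/= andbT sqrtr_gt0.
  by rewrite /F sqr_sqrtr// ltW.
have D0 (x : R) : x \in `]0%R, +oo[%R -> (0 < x)%R by rewrite in_itv/= andbT.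
have dF (x : R) : x \in `]0%R, +oo[%R -> is_derive x (1%R : R) F (f x)%R.
  move=> /D0 x0; by apply: is_derive_eq; rewrite /f -[LHS]/(x * 1 + x * 1)%R; ring.
have cf (x : R) : x \in `]0%R, +oo[%R -> {for x, continuous f}.
  by move=> _; exact: mulrl_continuous.
have f0 (x : R) : x \in `]0%R, +oo[%R -> (0 < f x)%R.
  by move=> /D0 x0; rewrite /f mulr_gt0.
pose H (x : R) := (x `^ (n.+1%:R / 2 - 1) * expR (- x))%:E.
have mH : measurable_fun setT H by apply/measurable_EFinP; rewrite /H; mfun.
have H0 x : 0 <= H x by rewrite lee_fin mulr_ge0 ?powR_ge0 ?expR_ge0.
have := @increasing_substitution R F f mF mf `]0%R, +oo[ H
  (segment_exhausted_oy 0) dF cf f0 mH H0.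
rewrite FD => ->.
rewrite -ge0_integralZr//; last 2 first.
- by apply/measurable_EFinP/measurable_funTS; mfun.
- by move=> x /D0 x0; rewrite lee_fin mulr_ge0 ?expR_ge0 ?exprn_ge0 ?ltW.
apply: eq_integral => x /set_mem/D0 x0; rewrite /H /F /f -!EFinM; congr (_%:E).
rewrite -(powR_mulrn 2) ?ltW// -powRrM.
have -> : (2%:R * (n.+1%:R / 2 - 1) = n%:R - 1 :> R)%R.
  by rewrite -natr1; field.
rewrite powRB; last by apply/implyP => _; rewrite gt_eqF.
rewrite powRr1 ?ltW// (powR_mulrn n) ?ltW//.
by field; rewrite gt_eqF.
Qed.

End one_dimensional.

(** * Euclidean norm and polar coordinates *)

Section euclidean_norm.
Context (R : realType) (n : nat).
Implicit Types x y : n.-tuple R.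

Definition tuple_scale (k : R) x : n.-tuple R := [tuple k * tnth x i | i < n].
Definition tuple_add x y : n.-tuple R := [tuple tnth x i + tnth y i | i < n].

Lemma eucl_norm_ge0 x : 0 <= eucl_norm x.
Proof. exact: sqrtr_ge0. Qed.

Lemma sqr_eucl_norm x : eucl_norm x ^+ 2 = \sum_(i < n) tnth x i ^+ 2.
Proof. by rewrite sqr_sqrtr// sumr_ge0// => i _; rewrite sqr_ge0. Qed.

Lemma eucl_normP x (r : R) : 0 <= r ->
  \sum_(i < n) tnth x i ^+ 2 = r ^+ 2 -> eucl_norm x = r.
Proof. by move=> r0 xr; rewrite /eucl_norm xr sqrtr_sqr ger0_norm. Qed.

Lemma eucl_norm_scale k x : 0 <= k ->
  eucl_norm (tuple_scale k x) = k * eucl_norm x.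
Proof.
move=> k0; apply: eucl_normP; first by rewrite mulr_ge0// eucl_norm_ge0.
rewrite exprMn sqr_eucl_norm big_distrr/=; apply: eq_bigr => i _.
by rewrite tnth_mktuple exprMn.
Qed.

Lemma tuple_scaleA k l x : tuple_scale k (tuple_scale l x) = tuple_scale (k * l) x.
Proof. by apply: eq_from_tnth => i; rewrite !tnth_mktuple mulrA. Qed.

Lemma directionE x : direction x = tuple_scale (eucl_norm x)^-1 x.
Proof. by apply: eq_from_tnth => i; rewrite !tnth_mktuple mulrC. Qed.

Lemma eucl_norm_direction x : 0 < eucl_norm x -> eucl_norm (direction x) = 1.
Proof.
move=> x0; rewrite directionE eucl_norm_scale ?invr_ge0 ?ltW//.
by rewrite mulVf ?gt_eqF.
Qed.

Lemma eucl_norm_eq0 x : eucl_norm x = 0 -> forall i, tnth x i = 0.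
Proof.
move=> x0 i; have := sqr_eucl_norm x; rewrite x0 expr0n/= => /esym/eqP.
rewrite psumr_eq0 => [/allP/(_ i)|j _]; last exact: sqr_ge0.
by rewrite mem_index_enum sqrf_eq0 => /(_ isT)/eqP.
Qed.

End euclidean_norm.

Lemma eucl_norm_cons (R : realType) n (a : R) (y : n.-tuple R) :
  eucl_norm [tuple of a :: y] = Num.sqrt (a ^+ 2 + eucl_norm y ^+ 2).
Proof.
rewrite {1}/eucl_norm big_ord_recl tnth0 sqr_eucl_norm; congr (Num.sqrt (_ + _)).
by apply: eq_bigr => i _; rewrite tnthS.
Qed.

Section measurability.
Context d (T : measurableType d) (R : realType).

Lemma measurable_tuple_scale n (k : T -> R) (y : T -> n.-tuple R) :
  measurable_fun setT k -> measurable_fun setT y ->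
  measurable_fun setT (fun x => tuple_scale (k x) (y x)).
Proof. by move=> mk my; rewrite /tuple_scale; mfun. Qed.

Lemma measurable_tuple_add n (x y : T -> n.-tuple R) :
  measurable_fun setT x -> measurable_fun setT y ->
  measurable_fun setT (fun z => tuple_add (x z) (y z)).
Proof. by move=> mx my; rewrite /tuple_add; mfun. Qed.

Lemma measurable_direction n (x : T -> n.-tuple R) :
  measurable_fun setT x -> measurable_fun setT (fun z => direction (x z)).
Proof.
move=> mx; under eq_fun do rewrite directionE.
by apply: measurable_tuple_scale; mfun.
Qed.

End measurability.

Ltac mfunt := repeat (mfun; try first
  [ apply: measurable_tuple_scale | apply: measurable_tuple_add
  | apply: measurable_direction]).

Section tuple_integrals.
Local Open Scope ereal_scope.
Context (R : realType).
Local Notation leb := (@lebesgue_measure R).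
Local Notation lam n := (lebesgue_tuple R n).

Lemma integral_tuple_scale n (F : n.-tuple R -> \bar R) (k : R) :
  (0 < k)%R -> measurable_fun setT F -> (forall x, 0 <= F x) ->
  \int[lam n]_x F (tuple_scale k x) = (k ^- n)%:E * \int[lam n]_x F x.
Proof.
move=> k0 mF F0; pose z : n.-tuple R := [tuple 0%R | i < n].
rewrite -(@integral_tuple_affine R n F k z k0 mF F0).
apply: eq_integral => x _; congr F; apply: eq_from_tnth => i.
by rewrite !tnth_mktuple add0r.
Qed.

Lemma integral_tuple_add n (F : n.-tuple R -> \bar R) b :
  measurable_fun setT F -> (forall x, 0 <= F x) ->
  \int[lam n]_x F (tuple_add b x) = \int[lam n]_x F x.
Proof.
move=> mF F0; rewrite -[RHS]mul1e.
have -> : 1 = (1 ^- n)%:E :> \bar R by rewrite expr1n invr1.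
rewrite -(@integral_tuple_affine R n F 1 b ltr01 mF F0).
apply: eq_integral => x _; congr F; apply: eq_from_tnth => i.
by rewrite !tnth_mktuple mul1r.
Qed.

Lemma measurable_integral d1 d2 (T1 : measurableType d1) (T2 : measurableType d2)
    (m2 : {sigma_finite_measure set T2 -> \bar R}) (f : T1 -> T2 -> \bar R) :
  measurable_fun setT (fun z => f z.1 z.2) -> (forall x y, 0 <= f x y) ->
  measurable_fun setT (fun x => \int[m2]_y f x y).
Proof.
move=> mf f0.
exact: (measurable_fun_fubini_tonelli_F (fun z => f z.1 z.2) mf (fun=> f0 _ _)).
Qed.

(** The origin lies in the hyperplane where the first coordinate vanishes, and off that hyperplane
    the two inner integrals coincide. *)
Lemma integral_tuple_neq0 n (F : n.+1.-tuple R -> \bar R) :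
  measurable_fun setT F -> (forall x, 0 <= F x) ->
  \int[lam n.+1]_x ((0 < eucl_norm x)%R%:R%:E * F x) = \int[lam n.+1]_x F x.
Proof.
move=> mF F0; have mb : measurable_fun setT (fun x : n.+1.-tuple R =>
    (0 < eucl_norm x)%R) by mfun.
have mcons : measurable_fun setT (fun z : R * n.-tuple R => [tuple of z.1 :: z.2]).
  by mfun.
rewrite !integral_cons//; last 2 first.
- by apply: emeasurable_funM => //; apply/measurable_EFinP; mfunt.
- by move=> x; rewrite mule_ge0// lee_fin.
apply: ge0_ae_eq_integral => //.
- apply: (@measurable_integral _ _ _ _ (lam n) (fun a y => _ * _)).
    apply: emeasurable_funM; last exact: (measurableT_comp mF mcons).
    by apply/measurable_EFinP; mfun.
  by move=> *; rewrite mule_ge0// lee_fin.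
- apply: (@measurable_integral _ _ _ _ (lam n) (fun a y => F [tuple of a :: y])) => //.
  exact: (measurableT_comp mF mcons).
- by move=> a _; apply: integral_ge0 => *; rewrite mule_ge0// lee_fin.
- by move=> a _; exact: integral_ge0.
exists [set 0%R]; split => //; first exact: lebesgue_measure_set1.
move=> a /=; apply: contra_notP => a0 _; apply: eq_integral => y _.
rewrite eucl_norm_cons sqrtr_gt0 ltr_wpDr ?sqr_ge0 ?mul1e//.
by rewrite exprn_even_gt0//=; exact/eqP.
Qed.

Local Notation N w := (eucl_norm w).

(** Polar coordinates in which the angle is the direction of a point [w] of the unit ball. Rescaling
    r by the norm of [w] gives [K1]; exchanging the integrals and putting y = r w gives [K3]. What
    remains for each y is the norm of y to the power n + 1, times the integral of r^(-n-2) over r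
    larger than that norm: this is 1 / (n + 1), whatever y. *)
Lemma polar n (G : n.+1.-tuple R -> \bar R) :
  measurable_fun setT G -> (forall x, 0 <= G x) ->
  \int[lam n.+1]_w \int[leb]_r
    ((((0 < eucl_norm w < 1) && (0 < r))%R%:R * r ^+ n)%:E *
     G (tuple_scale (r / eucl_norm w) w))
  = (n.+1%:R^-1)%:E * \int[lam n.+1]_y G y.
Proof.
move=> mG G0.
have nat0 (b : bool) : (0 <= b%:R :> R)%R by [].
pose K1 (w : n.+1.-tuple R) (r : R) := (((0 < N w < 1) && (0 < r))%R%:R *
  (N w ^+ n.+1 * r ^+ n))%:E * G (tuple_scale r w).
pose K3 (r : R) (y : n.+1.-tuple R) :=
  (((0 < N y < r) && (0 < r))%R%:R * (N y ^+ n.+1 * r ^- n.+2))%:E * G y.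
have K10 w r : 0 <= K1 w r.
  rewrite /K1; have [r0|r0] := ltP 0%R r; last by rewrite andbF mul0r mul0e.
  by rewrite mule_ge0// lee_fin !mulr_ge0 ?exprn_ge0 ?eucl_norm_ge0// ltW.
have K30 r y : 0 <= K3 r y.
  rewrite /K3; have [r0|r0] := ltP 0%R r; last by rewrite andbF mul0r mul0e.
  by rewrite mule_ge0// lee_fin !mulr_ge0 ?invr_ge0 ?exprn_ge0 ?eucl_norm_ge0// ltW.
have mK1 : measurable_fun setT (fun z => K1 z.1 z.2).
  apply: emeasurable_funM; first by apply/measurable_EFinP; mfun.
  by apply: (measurableT_comp mG); mfunt.
have mK3 : measurable_fun setT (fun z => K3 z.1 z.2).
  apply: emeasurable_funM; last exact: (measurableT_comp mG measurable_snd).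
  by apply/measurable_EFinP; mfun.
transitivity (\int[lam n.+1]_w \int[leb]_r K1 w r).
  apply: eq_integral => w _; have [Nw|Nw] := boolP (0 < N w < 1)%R; last first.
    rewrite [LHS]integral0_eq ?[RHS]integral0_eq// => r _; rewrite /K1.
      by rewrite ?(negbTE Nw) mul0r mul0e.
    by rewrite ?(negbTE Nw) mul0r mul0e.
  have N0 : (0 < N w)%R by case/andP: Nw.
  pose F (r : R) := ((0 < r)%R%:R * r ^+ n)%:E * G (tuple_scale (r / N w) w).
  have mF : measurable_fun setT F.
    apply: emeasurable_funM; first by apply/measurable_EFinP; mfun.
    by apply: (measurableT_comp mG); mfunt.
  have F0 r : 0 <= F r.
    rewrite /F; have [r0|r0] := ltP 0%R r; last by rewrite mul0r mul0e.
    by rewrite mule_ge0// lee_fin !mulr_ge0 ?exprn_ge0// ltW.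
  transitivity (\int[leb]_r F r); first by apply: eq_integral => r _; rewrite ?Nw.
  have := integral_affine 0 N0 mF F0.
  move=> /(congr1 (fun x => (N w)%:E * x)).
  rewrite muleA -EFinM divff ?gt_eqF// mul1e => <-.
  rewrite -ge0_integralZl//; last 2 first.
  - apply: (measurableT_comp mF); mfun.
  - by rewrite lee_fin ltW.
  apply: eq_integral => r _; rewrite /F /K1 add0r ?Nw pmulr_rgt0//.
  rewrite muleA -EFinM mulrAC divff ?gt_eqF// mul1r; congr (_%:E * _).
  by rewrite exprMn exprS; ring.
rewrite (@fubini_tonelli_in _ _ _ _ _ (lam n.+1) leb setT setT)//.
transitivity (\int[leb]_r \int[lam n.+1]_y K3 r y).
  apply: eq_integral => r _; have [r0|r0] := ltP 0%R r; last first.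
    rewrite [LHS]integral0_eq ?[RHS]integral0_eq// => y _; rewrite /K1 /K3.
      by rewrite ?(ltNge 0%R) ?r0 andbF mul0r mul0e.
    by rewrite ?(ltNge 0%R) ?r0 andbF mul0r mul0e.
  pose F (y : n.+1.-tuple R) :=
    ((0 < N y < r)%R%:R * ((N y / r) ^+ n.+1 * r ^+ n))%:E * G y.
  have mF : measurable_fun setT F.
    by apply: emeasurable_funM => //; apply/measurable_EFinP; mfun.
  have F0 y : 0 <= F y.
    by rewrite /F mule_ge0// lee_fin !mulr_ge0 ?exprn_ge0 ?divr_ge0 ?eucl_norm_ge0// ltW.
  transitivity (\int[lam n.+1]_w F (tuple_scale r w)).
    apply: eq_integral => w _; rewrite /F /K1 eucl_norm_scale ?ltW//.
    rewrite pmulr_rgt0// gtr_pMr// ?r0 andbT mulrAC divff ?gt_eqF// mul1r.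
    by [].
  rewrite integral_tuple_scale// -ge0_integralZl ?lee_fin ?invr_ge0 ?exprn_ge0 ?ltW//.
  apply: eq_integral => y _; rewrite /F /K3 muleA -EFinM ?r0 andbT.
  congr (_%:E * _); rewrite expr_div_n !exprS.
  by field; rewrite ?expf_neq0 ?gt_eqF.
rewrite (@fubini_tonelli_in _ _ _ _ _ leb (lam n.+1) setT setT)//.
rewrite -integral_tuple_neq0// -ge0_integralZl ?lee_fin//; last 2 first.
- by apply: emeasurable_funM => //; apply/measurable_EFinP; mfun.
- by move=> x _; rewrite mule_ge0// lee_fin.
apply: eq_integral => y _; rewrite /K3.
have [Ny|Ny] := boolP (0 < N y)%R; last first.
  by rewrite ?(negbTE Ny) mul0e mule0 integral0_eq// => r _; rewrite mul0r mul0e.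
rewrite ?Ny mul1e ge0_integralZr//; last 2 first.
- by apply/measurable_EFinP; mfun.
- move=> r _; rewrite lee_fin; have [r0|r0] := ltP 0%R r; last by rewrite andbF mul0r.
  by rewrite !mulr_ge0 ?invr_ge0 ?exprn_ge0 ?eucl_norm_ge0// ltW.
congr (_ * _).
have NnV : (0 <= N y ^+ n.+1)%R by rewrite exprn_ge0// ltW.
transitivity (\int[leb]_(r in `]N y, +oo[)
   ((N y ^+ n.+1)%:E * (r `^ (- n.+1%:R - 1))%:E)).
  rewrite (integral_mkbool leb (fun r => r \in `]N y, +oo[%R)).
  apply: eq_integral => r _; rewrite in_itv/= andbT.
  have [Nyr|Nyr] := ltP (N y) r; last by rewrite mul0r mul0e.
  have r0 := lt_trans Ny Nyr.
  rewrite r0 mul1r mul1e -EFinM; congr (_ * _)%:E.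
  by rewrite -opprD natr1 powR_invn// ltW.
rewrite ge0_integralZl//; last 2 first.
- by apply/measurable_EFinP/measurable_funTS; mfun.
- by move=> r _; rewrite lee_fin powR_ge0.
rewrite integral_powR_tail// -EFinM powR_invn ?ltW// mulrA divff ?mul1r//.
by rewrite gt_eqF// exprn_gt0.
Qed.
End tuple_integrals.

(** * Volume of the unit ball *)

Section ball_volume.
Local Open Scope ereal_scope.
Context (R : realType).
Local Notation leb := (@lebesgue_measure R).
Local Notation lam n := (lebesgue_tuple R n).
Local Notation N w := (eucl_norm w).

Lemma measurable_eucl_ball n (r : R) : measurable (@eucl_ball R n r).
Proof.
have mb : measurable_fun setT (fun x : n.-tuple R => (N x < r)%R) by mfun.
by rewrite -[eucl_ball r]setTI; exact: (mb measurableT [set true]).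
Qed.

Lemma integral_punctured_ball n :
  \int[lam n.+1]_w (0 < N w < 1)%R%:R%:E = lam n.+1 (eucl_ball 1).
Proof.
transitivity (\int[lam n.+1]_w (\1_(eucl_ball 1) w)%:E : \bar R); last first.
  by rewrite integral_indic ?setIT//; exact: measurable_eucl_ball.
rewrite -[RHS]integral_tuple_neq0; last 2 first.
- apply/measurable_EFinP; apply: measurable_indic; exact: measurable_eucl_ball.
- by move=> w; rewrite lee_fin.
apply: eq_integral => w _; rewrite -EFinM indicE -natrM mulnb; congr (_%:R%:E).
by congr (_ && _); apply/idP/idP => [|/set_mem//] w1; apply/mem_set.
Qed.

(** For a radial function the inner integral of [polar] does not depend on [w], so integrating over
    [w] only multiplies it by the volume of the ball. The area of the unit sphere appears as n + 1
    times that volume. *)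
Lemma integral_radial n (h : R -> \bar R) :
  measurable_fun setT h -> (forall r, 0 <= h r) ->
  \int[lam n.+1]_x h (N x) = n.+1%:R%:E * lam n.+1 (eucl_ball 1) *
    \int[leb]_(r in `]0%R, +oo[) ((r ^+ n)%:E * h r).
Proof.
move=> mh h0; have mG : measurable_fun setT (fun x : n.+1.-tuple R => h (N x)).
  by apply: (measurableT_comp mh); mfun.
have := polar mG (fun=> h0 _).
set I := \int[leb]_(r in _) _.
have I0 : 0 <= I.
  by apply: integral_ge0 => r /=; rewrite in_itv/= andbT => r0;
    rewrite mule_ge0// lee_fin exprn_ge0// ltW.
have -> : \int[lam n.+1]_w \int[leb]_r
    ((((0 < N w < 1) && (0 < r))%R%:R * r ^+ n)%:E *
     h (N (tuple_scale (r / N w) w))) = I * lam n.+1 (eucl_ball 1).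
  rewrite -integral_punctured_ball -ge0_integralZl//; last first.
    by apply/measurable_EFinP; mfun.
  apply: eq_integral => w _; have [/andP[Nw _]|Nw] := boolP (0 < N w < 1)%R; last first.
    by rewrite mule0 integral0_eq// => r _; rewrite mul0r mul0e.
  rewrite mule1 /I [RHS](integral_mkbool leb (fun r => r \in `]0%R, +oo[%R)).
  apply: eq_integral => r _; rewrite in_itv/= andbT.
  have [r0|r0] := ltP 0%R r; last by rewrite mul0r !mul0e.
  rewrite !mul1r mul1e eucl_norm_scale ?divr_ge0 ?ltW//.
  by rewrite divfK ?gt_eqF.
move=> /(congr1 (fun x => n.+1%:R%:E * x)).
rewrite [RHS]muleA -EFinM divff ?mul1e//.
by rewrite -muleA (muleC _ I).
Qed.

Lemma integral_gauss_tuple n :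
  \int[lam n]_x (expR (- N x ^+ 2))%:E = (Num.sqrt pi ^+ n)%:E :> \bar R.
Proof.
elim: n => [|n IH].
  rewrite [LHS](@integral_dirac _ _ [tuple] R setT)//=; last first.
    by apply/measurable_EFinP; mfun.
  by rewrite diracT mul1e sqr_eucl_norm big_ord0 oppr0 expR0.
rewrite integral_cons; last 2 first.
- by apply/measurable_EFinP; mfun.
- by move=> x; rewrite lee_fin expR_ge0.
transitivity (\int[leb]_a ((expR (- a ^+ 2))%:E * (Num.sqrt pi ^+ n)%:E)).
  apply: eq_integral => a _; rewrite -IH -ge0_integralZl ?lee_fin ?expR_ge0//.
  - apply: eq_integral => y _; rewrite eucl_norm_cons sqr_sqrtr; last first.
      by rewrite addr_ge0 ?sqr_ge0.
    by rewrite opprD expRD EFinM.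
  - by apply/measurable_EFinP; mfun.
rewrite ge0_integralZr ?lee_fin ?exprn_ge0 ?sqrtr_ge0//.
- by have -> := @integralT_gauss R; rewrite -EFinM exprS.
- by apply/measurable_EFinP; mfun.
Qed.

(** The Gaussian integral is computed coordinate by coordinate and radially. As the common value is
    positive and finite, so are both factors of the radial form, the volume and the Gamma integral;
    no separate estimate is made for either. *)
Lemma ball_volume n : exists2 v : R, lam n.+1 (eucl_ball 1) = v%:E &
  [/\ (0 < v)%R, (0 < Gamma (n.+1%:R / 2 : R))%R &
      (n.+1%:R * v * Gamma (n.+1%:R / 2) = 2 * Num.sqrt pi ^+ n.+1)%R].
Proof.
have h0 r : 0 <= (expR (- r ^+ 2))%:E :> \bar R by rewrite lee_fin expR_ge0.
have mh : measurable_fun setT (fun r : R => (expR (- r ^+ 2))%:E).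
  by apply/measurable_EFinP; mfun.
have E := integral_radial n mh h0; rewrite integral_gauss_tuple in E.
set I := \int[leb]_(r in _) _ in E.
have GI : Gamma (n.+1%:R / 2) = fine (I * 2%:E).
  by rewrite /Gamma /Rintegral -Gamma_gauss; congr (fine (_ * _)).
have pi0 : (0 < Num.sqrt pi ^+ n.+1 :> R)%R by rewrite exprn_gt0// sqrtr_gt0 pi_gt0.
have I0 : 0 <= I.
  by apply: integral_ge0 => r; rewrite /= in_itv/= andbT => r0;
    rewrite lee_fin mulr_ge0 ?expR_ge0 ?exprn_ge0// ltW.
have n0 : (0 < n.+1%:R :> R)%R by [].
have V0 : 0 <= lam n.+1 (eucl_ball 1) by [].
have VI0 : 0 < n.+1%:R%:E * lam n.+1 (eucl_ball 1) * I by rewrite -E lte_fin.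
have VIy : n.+1%:R%:E * lam n.+1 (eucl_ball 1) * I < +oo by rewrite -E ltry.
have {}I0 : 0 < I.
  by rewrite lt0e I0 andbT; apply: contraTneq VI0 => ->; rewrite mule0 ltxx.
have {}V0 : 0 < lam n.+1 (eucl_ball 1).
  by rewrite lt0e V0 andbT; apply: contraTneq VI0 => ->; rewrite mule0 mul0e ltxx.
have Vfin : lam n.+1 (eucl_ball 1) \is a fin_num.
  rewrite ge0_fin_numE ?ltW// ltey; apply: contraTneq VIy => ->.
  by rewrite gt0_muley ?lte_fin// gt0_mulye// ltxx.
have Ifin : I \is a fin_num.
  rewrite ge0_fin_numE ?ltW// ltey; apply: contraTneq VIy => ->.
  by rewrite gt0_muley ?ltxx// mule_gt0// lte_fin.
exists (fine (lam n.+1 (eucl_ball 1))); first by rewrite fineK.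
rewrite GI -(fineK Ifin) /=; split.
- by rewrite -lte_fin fineK.
- by rewrite mulr_gt0// -lte_fin fineK.
- move: E; rewrite -(fineK Ifin) -(fineK Vfin) -!EFinM => -[->] /=.
  by rewrite mulrA [RHS]mulrC.
Qed.
End ball_volume.

(** * Reflections *)

Section dot_product.
Context (R : realType) (n : nat).
Implicit Types x y u w : n.-tuple R.

Definition dot x y : R := \sum_(i < n) tnth x i * tnth y i.

Lemma dotC x y : dot x y = dot y x.
Proof. by apply: eq_bigr => i _; rewrite mulrC. Qed.

Lemma dotDr x y z : dot x (tuple_add y z) = dot x y + dot x z.
Proof. by rewrite -big_split; apply: eq_bigr => i _; rewrite tnth_mktuple mulrDr. Qed.

Lemma dotZr k x y : dot x (tuple_scale k y) = k * dot x y.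
Proof. by rewrite big_distrr; apply: eq_bigr => i _; rewrite tnth_mktuple/= mulrCA. Qed.

Lemma dotDl x y z : dot (tuple_add x y) z = dot x z + dot y z.
Proof. by rewrite dotC dotDr !(dotC z). Qed.

Lemma dotZl k x y : dot (tuple_scale k x) y = k * dot x y.
Proof. by rewrite dotC dotZr dotC. Qed.

Lemma dotxx x : dot x x = eucl_norm x ^+ 2.
Proof. by rewrite sqr_eucl_norm; apply: eq_bigr => i _; rewrite expr2. Qed.

Lemma eucl_normE x : eucl_norm x = Num.sqrt (dot x x).
Proof. by rewrite dotxx sqrtr_sqr ger0_norm// eucl_norm_ge0. Qed.

(** For [u] = 0, division by zero makes this the identity. The case does occur: in [integral_dot],
    when x already lies on the positive first axis. *)
Definition reflection u w : n.-tuple R :=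
  tuple_add w (tuple_scale (- (2 * dot u w / dot u u)) u).

Lemma dot0 u : dot u u = 0 -> forall w, dot u w = 0.
Proof.
rewrite dotxx => /eqP; rewrite sqrf_eq0 => /eqP/eucl_norm_eq0 u0 w.
by rewrite /dot big1// => i _; rewrite u0 mul0r.
Qed.

Lemma dot_reflection u w : dot u (reflection u w) = - dot u w.
Proof.
rewrite dotDr dotZr; have [/dot0->|u0] := eqVneq (dot u u) 0; last by field.
by rewrite mulr0 mul0r oppr0 mul0r addr0.
Qed.

Lemma reflection_norm u w : eucl_norm (reflection u w) = eucl_norm w.
Proof.
rewrite !eucl_normE; congr (Num.sqrt _).
rewrite {1}/reflection dotDl dotZl dot_reflection dotDr dotZr (dotC w u).
have [/dot0->|u0] := eqVneq (dot u u) 0; last by field.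
by rewrite !(mulr0, mul0r, oppr0, addr0).
Qed.

(** Linearity and involutivity, in the one form in which [integral_reflection] uses them. *)
Lemma reflection_add u x y :
  reflection u (tuple_add (reflection u y) x) = tuple_add y (reflection u x).
Proof.
apply: eq_from_tnth => i; rewrite !tnth_mktuple dotDr dot_reflection.
have [/dot0 u0|u0] := eqVneq (dot u u) 0; last by field.
by rewrite !u0; ring.
Qed.

Lemma measurable_reflection d (T : measurableType d) u (f : T -> n.-tuple R) :
  measurable_fun setT f -> measurable_fun setT (fun z => reflection u (f z)).
Proof.
move=> mf; apply: measurable_tuple_add => //; apply: measurable_tuple_scale => //.
apply: measurable_funN; apply: measurable_funM => //; apply: measurable_funM => //.
by apply: measurable_sum => i; mfun.
Qed.

End dot_product.

Section orthogonal_invariance.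
Local Open Scope ereal_scope.
Context (R : realType).
Local Notation leb := (@lebesgue_measure R).
Local Notation lam n := (lebesgue_tuple R n).
Local Notation N w := (eucl_norm w).

(* As for the uniqueness of Haar measure: F (Q x) exp (- |y - Q x|^2), Q the
   reflection, is integrated over x and y by translating y for each x, or by
   translating x for each y and then y for each x. *)
Lemma integral_reflection n (u : n.-tuple R) (F : n.-tuple R -> \bar R) :
  measurable_fun setT F -> (forall x, 0 <= F x) ->
  \int[lam n]_x F (reflection u x) = \int[lam n]_x F x.
Proof.
move=> mF F0; pose Q := @reflection R n u.
pose g (x : n.-tuple R) := (expR (- N x ^+ 2))%:E.
have mg : measurable_fun setT g by apply/measurable_EFinP; mfun.
have g0 x : 0 <= g x by rewrite lee_fin expR_ge0.
have ig : \int[lam n]_x g x = (Num.sqrt pi ^+ n)%:E by exact: integral_gauss_tuple.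
have mQ : measurable_fun setT Q by exact: measurable_reflection.
pose opp (x : n.-tuple R) := tuple_scale (-1) x.
have gQ x : g (Q x) = g x by rewrite /g reflection_norm.
have gopp x y : g (tuple_add (opp (tuple_add y x)) y) = g x.
  rewrite /g (_ : tuple_add _ _ = opp x); last first.
    by apply: eq_from_tnth => i; rewrite !tnth_mktuple; ring.
  by rewrite !sqr_eucl_norm; congr (expR (- _))%:E; apply: eq_bigr => i _;
    rewrite tnth_mktuple mulN1r sqrrN.
have mFQ : measurable_fun setT (F \o Q) by exact: measurableT_comp.
pose K (x y : n.-tuple R) := F (Q x) * g (tuple_add (opp (Q x)) y).
have mK : measurable_fun setT (fun z => K z.1 z.2).
  apply: emeasurable_funM.
    exact: (measurableT_comp mFQ measurable_fst).
  apply: (measurableT_comp mg); apply: measurable_tuple_add => //.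
  apply: measurable_tuple_scale => //.
  exact: (measurableT_comp mQ measurable_fst).
have K0 x y : 0 <= K x y by rewrite mule_ge0.
have E : \int[lam n]_x F (Q x) * (Num.sqrt pi ^+ n)%:E =
         \int[lam n]_x F x * (Num.sqrt pi ^+ n)%:E.
  transitivity (\int[lam n]_x \int[lam n]_y K x y).
    rewrite -ge0_integralZr ?lee_fin ?exprn_ge0 ?sqrtr_ge0//.
    apply: eq_integral => x _; rewrite ge0_integralZl//; last first.
      by apply: (measurableT_comp mg); mfunt.
    by rewrite integral_tuple_add// ig.
  rewrite (@fubini_tonelli_in _ _ _ _ _ (lam n) (lam n) setT setT)//.
  transitivity (\int[lam n]_y \int[lam n]_x (F (tuple_add y (Q x)) * g x)).
    apply: eq_integral => y _.
    transitivity (\int[lam n]_x K (tuple_add (Q y) x) y).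
      apply/esym/(@integral_tuple_add R n (fun x => K x y)) => //.
      exact: (measurable_fun_pair1 y mK).
    apply: eq_integral => x _; rewrite /K.
    have -> : Q (tuple_add (Q y) x) = tuple_add y (Q x) := reflection_add u x y.
    by rewrite gopp gQ.
  have mFadd : measurable_fun setT (fun z : n.-tuple R * n.-tuple R =>
      F (tuple_add z.1 (Q z.2))).
    apply: (measurableT_comp mF); apply: measurable_tuple_add => //.
    exact: (measurableT_comp mQ measurable_snd).
  transitivity (\int[lam n]_x \int[lam n]_y (F (tuple_add y (Q x)) * g x)).
    apply: fubini_tonelli_in;
      [exact: measurableT|exact: measurableT| |by move=> y x; rewrite mule_ge0].
    by apply: emeasurable_funM => //; exact: (measurableT_comp mg measurable_snd).
  rewrite -ig muleC -ge0_integralZr//; last exact: integral_ge0.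
  apply: eq_integral => x _; rewrite ge0_integralZr//; last first.
    exact: (measurable_fun_pair1 x mFadd).
  rewrite muleC; congr (_ * _); rewrite -[RHS](@integral_tuple_add R n F (Q x))//.
  by apply: eq_integral => y _; congr F; apply: eq_from_tnth => i;
    rewrite !tnth_mktuple addrC.
have pi0 : (0 < Num.sqrt pi ^+ n :> R)%R by rewrite exprn_gt0// sqrtr_gt0 pi_gt0.
move: E => /(congr1 (fun x => x * ((Num.sqrt pi ^+ n)^-1)%:E)).
by rewrite -!muleA -!EFinM divff ?gt_eqF// !mule1.
Qed.

Lemma integral_dot n (x : n.+1.-tuple R) (H : R -> R -> \bar R) :
  measurable_fun setT (fun z => H z.1 z.2) -> (forall a b, 0 <= H a b) ->
  \int[lam n.+1]_w H (N w) (dot x w) = \int[lam n.+1]_w H (N w) (N x * tnth w ord0)%R.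
Proof.
move=> mH H0; pose e : n.+1.-tuple R := [tuple (i == ord0)%:R | i < n.+1].
have de w : dot e w = tnth w ord0.
  rewrite /dot (bigD1 ord0)//= tnth_mktuple eqxx mul1r big1 ?addr0// => i i0.
  by rewrite tnth_mktuple (negbTE i0) mul0r.
(* Normal to the mirror that exchanges x with the vector of the same norm on the first axis. *)
pose u := tuple_add x (tuple_scale (- N x) e).
have dd w : dot u w = (dot x w - N x * tnth w ord0)%R.
  by rewrite dotDl dotZl de mulNr.
have du w : dot x (reflection u w) = (N x * tnth w ord0)%R.
  have xu : dot x u = (N x ^+ 2 - N x * tnth x ord0)%R by rewrite dotC dd dotxx.
  have u0E : tnth u ord0 = (tnth x ord0 - N x)%R.
    by rewrite !tnth_mktuple eqxx mulr1.
  (* Equality of the two norms gives this, and the coefficient of the reflection simplifies: the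
     inner product of x with the reflected w is [dot x w - dot u w]. *)
  have eu : (dot u u = 2 * dot x u)%R by rewrite dd xu u0E; ring.
  rewrite dotDr dotZr eu (dotC x u); have [u0|u0] := eqVneq (dot u x) 0%R.
    move: (eu); rewrite (dotC x u) u0 mulr0 => /dot0/(_ w); rewrite dd => /eqP.
    by rewrite subr_eq0 => /eqP ->; rewrite mulr0 addr0.
  by rewrite -[RHS](subKr (dot x w)) -dd; field.
rewrite -(@integral_reflection _ u)//; last first.
  have mN : measurable_fun setT (fun w : n.+1.-tuple R => N w) by mfun.
  have md : measurable_fun setT (fun w : n.+1.-tuple R => dot x w).
    by apply: measurable_sum => i; mfun.
  exact: (measurableT_comp mH (measurable_fun_pair mN md)).
by apply: eq_integral => w _; rewrite reflection_norm du.
Qed.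
End orthogonal_invariance.

(** * Marginals of the uniform direction *)

Section sphere_marginal.
Local Open Scope ereal_scope.
Context (R : realType).
Local Notation leb := (@lebesgue_measure R).
Local Notation lam n := (lebesgue_tuple R n).
Local Notation N w := (eucl_norm w).

Lemma sqr_lt1 (u : R) : (u \in `]-1, 1[ -> 0 < 1 - u ^+ 2)%R.
Proof. by rewrite in_itv/= => /andP[u1 u2]; nra. Qed.

Lemma powR12_sqrtN (x : R) : (0 < x -> x `^ (- (1 / 2)) = (Num.sqrt x)^-1)%R.
Proof. by move=> x0; rewrite powRN div1r powR12_sqrt// ltW. Qed.

(** The variable u is the sine of the angle whose tangent is x, that is, the first coordinate of the
    direction of (x, 1). *)
Lemma integral_line_ball (H : R -> \bar R) :
  measurable_fun setT H -> (forall x, 0 <= H x) ->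
  \int[leb]_x H x = \int[leb]_(u in `](-1)%R, 1%R[)
    (H (u * (1 - u ^+ 2) `^ (- (1 / 2)))%R * ((1 - u ^+ 2) `^ (- (3 / 2)))%:E).
Proof.
move=> mH H0; pose F (u : R) := (u * (1 - u ^+ 2) `^ (- (1 / 2)))%R.
pose f (u : R) := ((1 - u ^+ 2) `^ (- (3 / 2)))%R.
have mF : measurable_fun setT F by rewrite /F; mfun.
have mf : measurable_fun setT f by rewrite /f; mfun.
have FD : F @` `](-1)%R, 1%R[ = setT.
  rewrite -subTset => x _; pose s := Num.sqrt (1 + x ^+ 2).
  have x20 : (0 < 1 + x ^+ 2)%R by rewrite ltr_wpDr ?sqr_ge0.
  have s0 : (0 < s)%R by rewrite sqrtr_gt0.
  have s2 : (s ^+ 2 = 1 + x ^+ 2)%R by rewrite sqr_sqrtr// ltW.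
  exists (x / s)%R.
    rewrite /= in_itv/= ltr_pdivlMr// ltr_pdivrMr//.
    by apply/andP; split; nra.
  have u2 : (1 - (x / s) ^+ 2 = s ^- 2)%R.
    by rewrite expr_div_n s2; field; rewrite gt_eqF.
  rewrite /F u2 powR12_sqrtN ?invr_gt0 ?exprn_gt0// -exprVn sqrtr_sqr.
  by rewrite ger0_norm ?invr_ge0 ?ltW// invrK divfK// gt_eqF.
have dF (u : R) : u \in `]-1, 1[%R -> is_derive u (1%R : R) F (f u)%R.
  move=> /sqr_lt1 u1.
  have d1 : is_derive u (1%R : R) (fun u : R => 1 - u ^+ 2)%R (- (2 * u))%R.
    apply: is_derive_eq; rewrite -[LHS]/((0 + 1) * - (u * 1 + u * 1))%R; ring.
  have d2 := @is_derive1_comp R (@powR R ^~ (- (1 / 2))%R) (fun u => 1 - u ^+ 2)%R u _ _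
    (is_derive1_powR (- (1 / 2)) u1) d1.
  apply: is_derive_eq.
  rewrite -[LHS]/(u * (- (1 / 2) * (1 - u ^+ 2) `^ (- (1 / 2) - 1) * - (2 * u)) +
    (1 - u ^+ 2) `^ (- (1 / 2)) * 1)%R /f.
  have -> : (- (1 / 2) - 1 = - (3 / 2) :> R)%R by field.
  have -> : ((1 - u ^+ 2) `^ (- (1 / 2)) =
             (1 - u ^+ 2) `^ (- (3 / 2)) * (1 - u ^+ 2))%R.
    have -> : (- (1 / 2) = - (3 / 2) + 1 :> R)%R by field.
    rewrite powRD ?powRr1 ?ltW//.
    by apply/implyP => _; rewrite gt_eqF.
  by field.
have cf (u : R) : u \in `]-1, 1[%R -> {for u, continuous f}.
  move=> /sqr_lt1 u1.
  have d1 : is_derive u (1%R : R) (fun u : R => 1 - u ^+ 2)%R (- (2 * u))%R.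
    apply: is_derive_eq; rewrite -[LHS]/((0 + 1) * - (u * 1 + u * 1))%R; ring.
  have [dx _] := @is_derive1_comp R (@powR R ^~ (- (3 / 2))%R) (fun u => 1 - u ^+ 2)%R u _ _
    (is_derive1_powR (- (3 / 2)) u1) d1.
  by apply: differentiable_continuous; apply/derivable1_diffP.
have f0 (u : R) : u \in `]-1, 1[%R -> (0 < f u)%R.
  by move=> /sqr_lt1; exact: powR_gt0.
have := @increasing_substitution R F f mF mf `](-1)%R, 1%R[ H
  (segment_exhausted_oo _ _) dF cf f0 mH H0.
by rewrite FD.
Qed.

Lemma integral_exprn (n : nat) (s : R) : (0 < s)%R ->
  \int[leb]_(x in `]0%R, s[) (x ^+ n)%:E = (s ^+ n.+1 / n.+1%:R)%:E.
Proof.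
move=> s0.
pose F (x : R) := (x ^+ n.+1 / n.+1%:R)%R.
have cX (k : nat) (x : R) : {for x, continuous (fun y : R => y ^+ k)%R}.
  exact: exprn_continuous.
have dF (x : R) : is_derive x (1%R : R) F (x ^+ n)%R.
  have -> : F = (n.+1%:R^-1 \*: (@id R ^+ n.+1))%R.
    by apply/funext => y; rewrite /F exprfctE /= mulrC.
  apply: is_derive_eq; rewrite -[LHS]/(n.+1%:R^-1 * (n.+1%:R * x ^+ n * 1))%R.
  by rewrite mulr1 mulKf.
have cF (x : R) : {for x, continuous F}.
  by apply: differentiable_continuous; apply/derivable1_diffP; have [] := dF x.
have := @continuous_FTC2 R (fun x => x ^+ n)%R F 0%R s s0.
rewrite /F expr0n/= mul0r sube0 => <-.
- rewrite [RHS]integral_itv_bndoo//.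
  by apply/measurable_EFinP/measurable_funTS; mfun.
- by apply: continuous_subspaceT => y; exact: cX.
- split; first by move=> y _; have [] := dF y.
  + by apply: cvg_at_right_filter; exact: cF.
  + by apply: cvg_at_left_filter; exact: cF.
- by move=> y _; rewrite derive1E; have [_ ->] := dF y.
Qed.

(** Let a be the first coordinate and r the norm of the others. At fixed r, the substitution a = r u
    / sqrt(1 - u^2) makes u the first coordinate of the direction and r / sqrt(1 - u^2) the norm, so
    being in the ball means r < sqrt(1 - u^2). The integral of r^(n+1) up to this bound gives the
    exponent (n + 2) / 2 and the factor 1 / (n + 2); the Jacobian subtracts 3 / 2 from the
    exponent. *)
Lemma integral_first_coordinate n (psi : R -> \bar R) :
  measurable_fun setT psi -> (forall u, 0 <= psi u) ->
  \int[lam n.+2]_w ((0 < N w < 1)%R%:R%:E * psi (tnth w ord0 / N w)%R) =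
  (n.+1%:R / n.+2%:R)%:E * lam n.+1 (eucl_ball 1) *
  \int[leb]_(u in `](-1)%R, 1%R[) (psi u * ((1 - u ^+ 2) `^ ((n%:R - 1) / 2))%:E).
Proof.
move=> mpsi psi0.
pose h (a r : R) := ((0 < Num.sqrt (a ^+ 2 + r ^+ 2) < 1)%R%:R)%:E *
  psi (a / Num.sqrt (a ^+ 2 + r ^+ 2))%R.
have mh : measurable_fun setT (fun z => h z.1 z.2).
  apply: emeasurable_funM; first by apply/measurable_EFinP; mfun.
  by apply: (measurableT_comp mpsi); mfun.
have h0 a r : 0 <= h a r by rewrite mule_ge0// lee_fin.
rewrite integral_cons; last 2 first.
- apply: emeasurable_funM; first by apply/measurable_EFinP; mfun.
  by apply: (measurableT_comp mpsi); mfun.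
- by move=> w; rewrite mule_ge0// lee_fin.
have V0 : 0 <= n.+1%:R%:E * lam n.+1 (eucl_ball 1) by rewrite mule_ge0// lee_fin.
transitivity (\int[leb]_a (n.+1%:R%:E * lam n.+1 (eucl_ball 1) *
    \int[leb]_(r in `]0%R, +oo[) ((r ^+ n)%:E * h a r))).
  apply: eq_integral => a _.
  rewrite -(@integral_radial R n (h a))//; last exact: (measurable_fun_pair2 a mh).
  by apply: eq_integral => y _; rewrite /h eucl_norm_cons tnth0.
pose K1 (a r : R) := ((0 < r)%R%:R * r ^+ n)%:E * h a r.
have K10 a r : 0 <= K1 a r.
  rewrite /K1; have [r0|r0] := ltP 0%R r; last by rewrite mul0r mul0e.
  by rewrite mule_ge0// lee_fin mulr_ge0// exprn_ge0// ltW.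
have mK1 : measurable_fun setT (fun z => K1 z.1 z.2).
  by apply: emeasurable_funM => //; apply/measurable_EFinP; mfun.
have IK a : \int[leb]_(r in `]0%R, +oo[) ((r ^+ n)%:E * h a r) = \int[leb]_r K1 a r.
  rewrite (integral_mkbool leb (fun r => r \in `]0%R, +oo[%R)).
  apply: eq_integral => r _; rewrite /K1 in_itv/= andbT.
  by rewrite muleA -EFinM.
under eq_integral do rewrite IK.
rewrite ge0_integralZl//; last 2 first.
- exact: (@measurable_integral _ _ _ R (measurableTypeR R) leb K1 mK1 K10).
- by move=> a _; exact: integral_ge0.
have [v -> _] := ball_volume R n.
set J := \int[leb]_(u in _) _.
suff -> : \int[leb]_a \int[leb]_r K1 a r = (n.+2%:R^-1)%:E * J.
  by rewrite -!EFinM muleA -EFinM; congr (_%:E * _); ring.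
pose K2 (u r : R) := (((0 < r) && (r < Num.sqrt (1 - u ^+ 2)))%R%:R *
  (r ^+ n.+1 * (1 - u ^+ 2) `^ (- (3 / 2))))%:E * psi u.
have K20 u r : 0 <= K2 u r.
  rewrite /K2; have [r0|r0] := ltP 0%R r; last by rewrite mul0r mul0e.
  by rewrite mule_ge0// lee_fin !mulr_ge0 ?powR_ge0// exprn_ge0// ltW.
have mK2 : measurable_fun setT (fun z => K2 z.1 z.2).
  apply: emeasurable_funM; last exact: (measurableT_comp mpsi measurable_fst).
  by apply/measurable_EFinP; mfun.
rewrite (@fubini_tonelli_in _ _ _ _ _ leb leb setT setT K1)//.
transitivity (\int[leb]_r \int[leb]_(u in `](-1)%R, 1%R[) K2 u r).
  apply: eq_integral => r _; have [r0|r0] := ltP 0%R r; last first.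
    rewrite [LHS]integral0_eq ?[RHS]integral0_eq// => y _; rewrite /K1 /K2.
      by rewrite ?(ltNge 0%R) ?r0 mul0r mul0e.
    by rewrite ?(ltNge 0%R) ?r0 mul0r mul0e.
  have mhr : measurable_fun setT (h ^~ r) by exact: (measurable_fun_pair1 r mh).
  have mhrr : measurable_fun setT (fun b => h (r * b)%R r).
    by apply: (measurableT_comp mhr); mfun.
  transitivity (\int[leb]_b ((r ^+ n.+1)%:E * h (r * b)%R r)).
    rewrite [RHS]ge0_integralZl ?lee_fin ?exprn_ge0 ?ltW//.
    have -> : \int[leb]_b h (r * b)%R r = (r^-1)%:E * \int[leb]_a h a r.
      rewrite -(integral_affine 0 r0 mhr (fun=> h0 _ _)).
      by apply: eq_integral => b _; rewrite add0r.
    rewrite muleA -EFinM exprSr mulfK ?gt_eqF//.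
    rewrite -ge0_integralZl ?lee_fin ?exprn_ge0 ?ltW//.
    by apply: eq_integral => a _; rewrite /K1 ?r0 mul1r.
  rewrite integral_line_ball; last 2 first.
  - by apply: emeasurable_funM.
  - by move=> b; rewrite mule_ge0// lee_fin exprn_ge0// ltW.
  apply: eq_integral => u /set_mem/= /sqr_lt1 u1; rewrite /h /K2 powR12_sqrtN//.
  set q := Num.sqrt (1 - u ^+ 2).
  have q0 : (0 < q)%R by rewrite sqrtr_gt0.
  have q2 : (q ^+ 2 = 1 - u ^+ 2)%R by rewrite sqr_sqrtr// ltW.
  have -> : Num.sqrt ((r * (u * q^-1)) ^+ 2 + r ^+ 2) = (r / q)%R.
    rewrite (_ : _ + _ = (r / q) ^+ 2)%R; last first.
      rewrite !exprMn exprVn q2; field; rewrite gt_eqF//.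
    by rewrite sqrtr_sqr ger0_norm// divr_ge0// ltW.
  have -> : (r * (u * q^-1) / (r / q) = u)%R by field; rewrite !gt_eqF.
  rewrite divr_gt0// ltr_pdivrMr// mul1r ?r0.
  by rewrite [X in X * _ = _]muleA -EFinM muleAC -EFinM; congr (_%:E * _); ring.
rewrite -(@fubini_tonelli_in _ _ _ _ _ leb leb `](-1)%R, 1%R[ setT K2)//.
have mJ : measurable_fun setT (fun u => psi u * ((1 - u ^+ 2) `^ ((n%:R - 1) / 2))%:E).
  by apply: emeasurable_funM => //; apply/measurable_EFinP; mfun.
rewrite -ge0_integralZl//; last 2 first.
- exact: measurable_funTS.
- by move=> u _; rewrite mule_ge0// lee_fin powR_ge0.
apply: eq_integral => u /set_mem/= /sqr_lt1 u1.
rewrite /K2 ge0_integralZr//; last 2 first.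
- apply/measurable_EFinP; mfun.
- move=> r _; have [r0|r0] := ltP 0%R r; last by rewrite mul0r.
  by rewrite lee_fin !mulr_ge0 ?powR_ge0// exprn_ge0// ltW.
set q := Num.sqrt (1 - u ^+ 2).
have q0 : (0 < q)%R by rewrite sqrtr_gt0.
transitivity (((1 - u ^+ 2) `^ (- (3 / 2)))%:E *
  (\int[leb]_(r in `]0%R, q[) (r ^+ n.+1)%:E) * psi u).
  congr (_ * _); rewrite (integral_mkbool leb (fun r => r \in `]0%R, q[%R)).
  rewrite -ge0_integralZl ?lee_fin ?powR_ge0//; last 2 first.
  - have mI : measurable_fun setT (fun r : R => r \in `]0%R, q[%R).
      apply: (eq_measurable_fun (fun r : R => (0 < r) && (r < q))%R); last by mfun.
      by move=> r _; rewrite in_itv.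
    by apply: emeasurable_funM; apply/measurable_EFinP; mfun.
  - move=> r _; rewrite in_itv/= -EFinM; have [r0|r0] := ltP 0%R r; last by rewrite mul0r.
    by rewrite lee_fin mulr_ge0// exprn_ge0// ltW.
  by apply: eq_integral => r _; rewrite in_itv/= -!EFinM; congr (_%:E); ring.
rewrite integral_exprn// -EFinM.
rewrite [RHS]muleA muleAC [RHS]muleC -EFinM muleC; congr (_ * _%:E).
rewrite mulrA mulrC; congr (_ * _)%R.
have -> : (q ^+ n.+2 = (1 - u ^+ 2) `^ (n.+2%:R / 2))%R.
  by rewrite /q -powR12_sqrt ?ltW// -(powR_mulrn n.+2) ?powR_ge0// -powRrM mulrC.
rewrite -powRD; last by apply/implyP => _; rewrite gt_eqF.
by congr (_ `^ _)%R; rewrite -!natr1; field.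
Qed.

End sphere_marginal.

(** * Distance from a point to a uniform point of the sphere *)

Section distance_law.
Local Open Scope ereal_scope.
Context (R : realType).
Local Notation leb := (@lebesgue_measure R).
Local Notation lam n := (lebesgue_tuple R n).
Local Notation N w := (eucl_norm w).

(* Law of cosines in a triangle with sides r, 1 and s, s opposite the angle. *)
Definition cosine (r s : R) : R := (r ^+ 2 + 1 - s ^+ 2) / (2 * r).

(** Unnormalized density, in s, of the distance between a point of norm r and a uniform point of the
    sphere in dimension n + 2. The indicator is the triangle inequality, and s / r is minus the
    derivative of [cosine r]. *)
Definition distance_kernel n (r s : R) : R :=
  (`|r - 1| < s < r + 1)%R%:R * ((1 - cosine r s ^+ 2) `^ ((n%:R - 1) / 2) * (s / r)).

Lemma integral_cosine (r : R) (H : R -> \bar R) : (0 < r)%R ->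
  measurable_fun setT H -> (forall u, 0 <= H u) ->
  \int[leb]_(u in `](-1)%R, 1%R[) H u =
  \int[leb]_(s in `](`|r - 1|)%R, (r + 1)%R[) (H (cosine r s) * (s / r)%:E).
Proof.
move=> r0 mH H0.
have mF : measurable_fun setT (cosine r) by rewrite /cosine; mfun.
have mf : measurable_fun setT (fun s : R => s / r)%R by mfun.
have FD : cosine r @` `](`|r - 1|)%R, (r + 1)%R[ = `](-1)%R, 1%R[%classic.
  apply/seteqP; split => [_ [s/= + <-]|u/=]; rewrite !in_itv/=.
    move=> /andP[rs sr]; have s0 := le_lt_trans (normr_ge0 _) rs.
    rewrite /cosine ltr_pdivrMr ?ltr_pdivlMr ?mulr_gt0//.
    have rs2 : ((r - 1) ^+ 2 < s ^+ 2)%R.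
      by rewrite -real_normK ?num_real// ltrXn2r// ?nnegrE// ltW.
    by apply/andP; split; nra.
  move=> /andP[u1 u2].
  have ru1 : (0 < r * (1 + u))%R by rewrite mulr_gt0//; lra.
  have ru2 : (0 < r * (1 - u))%R by rewrite mulr_gt0//; lra.
  have rad : (0 < r ^+ 2 + 1 - 2 * r * u)%R by have := sqr_ge0 (r - 1); nra.
  exists (Num.sqrt (r ^+ 2 + 1 - 2 * r * u)).
    rewrite in_itv/=; apply/andP; split.
      by rewrite -sqrtr_sqr ltr_sqrt//; nra.
    have -> : (r + 1 = Num.sqrt ((r + 1) ^+ 2))%R.
      by rewrite sqrtr_sqr ger0_norm// addr_ge0// ltW.
    by rewrite ltr_sqrt ?exprn_gt0 ?addr_gt0//; nra.
  rewrite /cosine sqr_sqrtr; last exact: ltW.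
  by field; rewrite gt_eqF.
have D0 (s : R) : s \in `](`|r - 1|)%R, (r + 1)%R[%R -> (0 < s)%R.
  by rewrite in_itv/= => /andP[/(le_lt_trans (normr_ge0 _))].
have dF (s : R) : s \in `](`|r - 1|)%R, (r + 1)%R[%R ->
    is_derive s (1%R : R) (cosine r) (- (s / r))%R.
  move=> _; rewrite /cosine; apply: is_derive_eq.
  rewrite -[LHS]/((r ^+ 2 + 1 - s ^+ 2) * 0 +
    (2 * r)^-1 * ((0 + 1) * - (s * 1 + s * 1)))%R.
  by field; rewrite gt_eqF.
have cf (s : R) : s \in `](`|r - 1|)%R, (r + 1)%R[%R ->
    {for s, continuous (fun s : R => s / r)%R}.
  by move=> _; exact: mulrr_continuous.
have f0 (s : R) : s \in `](`|r - 1|)%R, (r + 1)%R[%R -> (0 < s / r)%R.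
  by move=> /D0 s0; rewrite divr_gt0.
have := @decreasing_substitution R (cosine r) (fun s => s / r)%R mF mf _ H
  (segment_exhausted_oo _ _) dF cf f0 mH H0.
by rewrite FD => /(_ (measurable_itv _)).
Qed.

(** The squared distance is r^2 + 1 minus twice the inner product of x with the direction of w,
    hence a function of [N w] and [dot x w]; [integral_dot] then replaces the inner product by the
    first coordinate, whose law is known. *)
Lemma integral_distance n (x : n.+2.-tuple R) (phi : R -> \bar R) :
  (0 < N x)%R -> measurable_fun setT phi -> (forall s, 0 <= phi s) ->
  \int[lam n.+2]_w ((0 < N w < 1)%R%:R%:E *
     phi (N (tuple_add x (tuple_scale (-1) (direction w))))) =
  (n.+1%:R / n.+2%:R)%:E * lam n.+1 (eucl_ball 1) *
  \int[leb]_s (phi s * (distance_kernel n (N x) s)%:E).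
Proof.
move=> x0 mphi phi0; pose r := N x.
pose H (a b : R) := (0 < a < 1)%R%:R%:E * phi (Num.sqrt (r ^+ 2 + 1 - 2 * (b / a)))%R.
transitivity (\int[lam n.+2]_w H (N w) (dot x w)).
  apply: eq_integral => w _; rewrite /H.
  have [/andP[w0 _]|_] := boolP (0 < N w < 1)%R; last by rewrite !mul0e.
  rewrite !mul1e; congr (phi _); rewrite eucl_normE; congr (Num.sqrt _).
  rewrite !(dotDl, dotDr, dotZl, dotZr) !dotxx eucl_norm_direction//.
  by rewrite (dotC _ x) directionE dotZr -/r; ring.
have mH : measurable_fun setT (fun z => H z.1 z.2).
  apply: emeasurable_funM; first by apply/measurable_EFinP; mfun.
  by apply: (measurableT_comp mphi); mfun.
rewrite integral_dot//; last by move=> a b; rewrite mule_ge0// lee_fin.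
pose psi (u : R) := phi (Num.sqrt (r ^+ 2 + 1 - 2 * r * u)).
have mpsi : measurable_fun setT psi by apply: (measurableT_comp mphi); mfun.
transitivity (\int[lam n.+2]_w
   ((0 < N w < 1)%R%:R%:E * psi (tnth w ord0 / N w)%R)).
  apply: eq_integral => w _; rewrite /H /psi; congr (_ * phi (Num.sqrt _)).
  by rewrite -/r !mulrA.
rewrite (integral_first_coordinate n mpsi (fun=> phi0 _)); congr (_ * _).
rewrite (@integral_cosine r)//; last 2 first.
- by apply: emeasurable_funM => //; apply/measurable_EFinP; mfun.
- by move=> u; apply: mule_ge0; [exact: phi0|rewrite lee_fin powR_ge0].
rewrite (integral_mkbool leb (fun s => s \in `](`|r - 1|)%R, (r + 1)%R[%R)).
apply: eq_integral => s _; rewrite in_itv/= /distance_kernel.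
have [/andP[rs sr]|_] := boolP (`|r - 1| < s < r + 1)%R; last first.
  by rewrite mul0e !mul0r mule0.
rewrite !mul1e !mul1r -muleA -EFinM /psi; congr (phi _ * _).
rewrite (_ : _ - _ = s ^+ 2)%R; last by rewrite /cosine; field; rewrite gt_eqF.
by rewrite sqrtr_sqr ger0_norm// (le_trans (normr_ge0 _) (ltW rs)).
Qed.
End distance_law.

(** * Two steps *)

Section distance_kernel_theory.
Context (R : realType) (n : nat).

Lemma distance_kernel_out (r s : R) : s <= 0 -> distance_kernel n r s = 0.
Proof.
move=> s0; rewrite /distance_kernel.
have -> : (`|r - 1| < s < r + 1) = false by rewrite ltNge (le_trans s0).
by rewrite mul0r.
Qed.

Lemma distance_kernel_ge0 (r s : R) : 0 <= r -> 0 <= distance_kernel n r s.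
Proof.
move=> r0; have [s0|/distance_kernel_out->//] := ltP 0 s.
by rewrite /distance_kernel mulr_ge0// mulr_ge0 ?powR_ge0// divr_ge0// ltW.
Qed.

Lemma measurable_distance_kernel d (T : measurableType d) (r s : T -> R) :
  measurable_fun setT r -> measurable_fun setT s ->
  measurable_fun setT (fun x => distance_kernel n (r x) (s x)).
Proof.
move=> mr ms; rewrite /distance_kernel /cosine.
have mabs : measurable_fun setT (fun x => `|r x - 1|).
  by apply: (measurableT_comp (@normr_measurable R setT)); mfun.
by mfun.
Qed.

End distance_kernel_theory.

Section two_steps.
Local Open Scope ereal_scope.
Context (R : realType).
Local Notation leb := (@lebesgue_measure R).
Local Notation lam n := (lebesgue_tuple R n).
Local Notation N w := (eucl_norm w).
Variables (t c : R) (beta : R -> R).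
Hypotheses (t0 : (0 < t)%R) (c0 : (0 < c)%R).
Hypotheses (mbeta : measurable_fun setT beta) (beta0 : forall s, (0 <= beta s)%R).
Hypothesis beta_out : forall s, s \notin `]0, t[%R -> beta s = 0%R.

(** If s has density [beta], this is the density of the ratio r = (t - s) / s: s = t / (1 + r), and
    t / (1 + r)^2 is the Jacobian. *)
Definition ratio_pdf (r : R) : R :=
  ((0 < r)%R%:R * (beta (t / (1 + r)) * (t / (1 + r) ^+ 2)))%R.

Lemma measurable_ratio_pdf : measurable_fun setT ratio_pdf.
Proof. by rewrite /ratio_pdf; mfun; apply: (measurableT_comp mbeta); mfun. Qed.

Lemma ratio_pdf_ge0 r : (0 <= ratio_pdf r)%R.
Proof. by rewrite /ratio_pdf !mulr_ge0 ?invr_ge0 ?sqr_ge0// ltW. Qed.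

Lemma ratio_pdf_out r : (r <= 0)%R -> ratio_pdf r = 0%R.
Proof. by move=> r0; rewrite /ratio_pdf ltNge r0 mul0r. Qed.

Lemma integral_ratio (g : R -> \bar R) : measurable_fun setT g ->
  (forall s, 0 <= g s) ->
  \int[leb]_s ((beta s)%:E * g s) =
  \int[leb]_r ((ratio_pdf r)%:E * g (t / (1 + r))%R).
Proof.
move=> mg g0; pose F (r : R) := (t / (1 + r))%R; pose f (r : R) := (t / (1 + r) ^+ 2)%R.
have mF : measurable_fun setT F by rewrite /F; mfun.
have mf : measurable_fun setT f by rewrite /f; mfun.
pose H s := (beta s)%:E * g s.
have mH : measurable_fun setT H by apply: emeasurable_funM => //; exact/measurable_EFinP.
have H0 s : 0 <= H s by rewrite mule_ge0// lee_fin.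
have FD : F @` `]0%R, +oo[ = `]0%R, t[%classic.
  apply/seteqP; split => [_ [r/= + <-]|s/=]; rewrite !in_itv/= ?andbT /F.
    move=> r0; have r1 : (0 < 1 + r)%R by rewrite addr_gt0.
    by rewrite divr_gt0//= ltr_pdivrMr// ltr_pMr// ltrDl.
  move=> /andP[s0 st]; exists ((t - s) / s)%R.
    by rewrite in_itv/= andbT divr_gt0// subr_gt0.
  by field; rewrite subrKC !gt_eqF.
have D0 (r : R) : r \in `]0%R, +oo[%R -> (0 < 1 + r)%R.
  by rewrite in_itv/= andbT => r0; rewrite addr_gt0.
have dF (r : R) : r \in `]0%R, +oo[%R -> is_derive r (1%R : R) F (- f r)%R.
  move=> /D0 r0; rewrite /F.
  have d1 : is_derive r (1%R : R) (fun r : R => 1 + r)%R 1%R.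
    by apply: is_derive_eq; rewrite add0r mulr1.
  have d2 := @is_deriveV R (fun r => 1 + r)%R r _ _ (lt0r_neq0 r0) d1.
  apply: is_derive_eq; rewrite -[LHS]/(t * (- (1 + r) ^- 2 * 1))%R.
  by rewrite mulr1 mulrN.
have cf (r : R) : r \in `]0%R, +oo[%R -> {for r, continuous f}.
  move=> /D0 r0; have d2 : derivable (fun r : R => (1 + r) ^+ 2)%R r 1%R by [].
  apply: continuousM; first exact: cst_continuous.
  apply: continuousV; first by rewrite expf_neq0 ?gt_eqF.
  by apply: differentiable_continuous; apply/derivable1_diffP.
have f0 (r : R) : r \in `]0%R, +oo[%R -> (0 < f r)%R.
  by move=> /D0 r0; rewrite /f divr_gt0// exprn_gt0.
have := @decreasing_substitution R F f mF mf _ H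
  (segment_exhausted_oy _) dF cf f0 mH H0.
rewrite FD => /(_ (measurable_itv _)) E.
transitivity (\int[leb]_(s in `]0%R, t[) H s).
  rewrite [RHS]integral_mkcond; apply: eq_integral => s _; rewrite patchE.
  case: ifPn => // st; rewrite /H beta_out ?mul0e//.
  by apply: contra st => st; apply/mem_set.
rewrite E (integral_mkbool leb (fun r => r \in `]0%R, +oo[%R)).
apply: eq_integral => r _; rewrite in_itv/= andbT /H /ratio_pdf.
by rewrite muleAC !muleA -!EFinM mulrA.
Qed.

Section fixed_dimension.
Variable n : nat.

(** Here r is the norm of the final position and s the ratio of the durations. The factor (1 + s) /
    (c t) undoes the scaling of V1 + s V2: its power n + 2 is the Jacobian of the dilation, its
    product with r the norm before scaling. Dividing by s^(n+1) cancels the weight of polar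
    coordinates. *)
Definition two_step_kernel (r s : R) : R :=
  (((1 + s) / (c * t)) ^+ n.+2 / s ^+ n.+1 *
   distance_kernel n ((1 + s) / (c * t) * r) s)%R.

Lemma time_ratio_step (v1 v2 : n.+2.-tuple R) r : (0 < r)%R ->
  tuple_scale c (tuple_add (tuple_scale (t / (1 + r)) v1)
    (tuple_scale (t - t / (1 + r)) v2)) =
  tuple_scale (c * t / (1 + r)) (tuple_add v1 (tuple_scale r v2)).
Proof.
move=> r0; apply: eq_from_tnth => i; rewrite !tnth_mktuple.
by field; rewrite gt_eqF// addr_gt0.
Qed.

Lemma two_step_kernel_ge0 r s : (0 <= r)%R -> (0 <= two_step_kernel r s)%R.
Proof.
move=> r0; rewrite /two_step_kernel; have [s0|/distance_kernel_out->] := ltP 0%R s.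
  have k0 : (0 <= (1 + s) / (c * t))%R.
    by rewrite divr_ge0 ?addr_ge0 ?mulr_ge0// ltW.
  rewrite mulr_ge0 ?distance_kernel_ge0 ?(mulr_ge0 k0)//.
  by rewrite divr_ge0// exprn_ge0// ltW.
by rewrite mulr0.
Qed.

Lemma measurable_two_step_kernel d (T : measurableType d) (r s : T -> R) :
  measurable_fun setT r -> measurable_fun setT s ->
  measurable_fun setT (fun x => two_step_kernel (r x) (s x)).
Proof.
move=> mr ms; rewrite /two_step_kernel; apply: measurable_funM; first by mfun.
by apply: measurable_distance_kernel; mfun.
Qed.

(** Here 1 / (n + 2) comes from [polar] and the rest of the constant from [integral_distance]; the
    normalizations of the two uniform laws enter later. *)
Lemma two_steps (f : n.+2.-tuple R -> \bar R) :
  measurable_fun setT f -> (forall x, 0 <= f x) ->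
  \int[lam n.+2]_w1 \int[lam n.+2]_w2 \int[leb]_s
    (((0 < N w1 < 1) && (0 < N w2 < 1))%R%:R%:E * ((beta s)%:E *
     f (tuple_scale c (tuple_add (tuple_scale s (direction w1))
                                 (tuple_scale (t - s) (direction w2))))))
  = (n.+2%:R^-1)%:E * ((n.+1%:R / n.+2%:R)%:E * lam n.+1 (eucl_ball 1)) *
    \int[lam n.+2]_z (f z * \int[leb]_s
      ((0 < N z)%R%:R * (beta s * two_step_kernel (N z) ((t - s) / s)))%:E).
Proof.
move=> mf f0.
have mg := measurable_ratio_pdf; have g0 := ratio_pdf_ge0.
pose W (w : n.+2.-tuple R) : R := (0 < N w < 1)%R%:R.
have W0 w : (0 <= W w)%R by [].
have mW : measurable_fun setT W by rewrite /W; mfun.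
pose GG (w y : n.+2.-tuple R) := (W w * (ratio_pdf (N y) / N y ^+ n.+1))%:E *
  f (tuple_scale (c * t / (1 + N y)) (tuple_add (direction w) y)).
have gN0 (y : n.+2.-tuple R) : (0 <= ratio_pdf (N y) / N y ^+ n.+1)%R.
  by rewrite divr_ge0// exprn_ge0// eucl_norm_ge0.
have GG0 w y : 0 <= GG w y by rewrite mule_ge0// lee_fin mulr_ge0.
have mGG : measurable_fun setT (fun z => GG z.1 z.2).
  apply: emeasurable_funM.
    apply/measurable_EFinP; apply: measurable_funM.
      exact: (measurableT_comp mW measurable_fst).
    apply: measurable_funM; last by mfun.
    by apply: (measurableT_comp mg); mfun.
  by apply: (measurableT_comp mf); mfunt.
pose phi (x : n.+2.-tuple R) (r : R) := (ratio_pdf r / r ^+ n.+1)%:E *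
  f (tuple_scale (c * t / (1 + r)) x).
have gr0 r : (0 <= ratio_pdf r / r ^+ n.+1)%R.
  have [r0|r0] := ltP 0%R r; first by rewrite divr_ge0// exprn_ge0// ltW.
  by rewrite ratio_pdf_out// mul0r.
have phi0 x r : 0 <= phi x r by rewrite mule_ge0// lee_fin.
have mphi : measurable_fun setT (fun z => phi z.1 z.2).
  apply: emeasurable_funM.
    apply/measurable_EFinP; apply: measurable_funM; last by mfun.
    by apply: (measurableT_comp mg); mfun.
  by apply: (measurableT_comp mf); mfunt.
pose D (w x : n.+2.-tuple R) := tuple_add x (tuple_scale (-1) (direction w)).
pose K (w x : n.+2.-tuple R) := (W w)%:E * phi x (N (D w x)).
have K0 w x : 0 <= K w x by rewrite mule_ge0// lee_fin.
have mK : measurable_fun setT (fun z => K z.1 z.2).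
  apply: emeasurable_funM.
    by apply/measurable_EFinP; exact: (measurableT_comp mW measurable_fst).
  have mD : measurable_fun setT (fun z : n.+2.-tuple R * n.+2.-tuple R => N (D z.1 z.2)).
    by apply: measurable_eucl_norm; rewrite /D; mfunt.
  exact: (measurableT_comp mphi (measurable_fun_pair measurable_snd mD)).
have [v Vv _] := ball_volume R n.
rewrite Vv -!EFinM; set C' := (n.+1%:R / n.+2%:R * v)%R.
have v0 : (0 <= v)%R by rewrite -lee_fin -Vv.
have C'0 : (0 <= C')%R by rewrite /C' !mulr_ge0.
pose L (x : n.+2.-tuple R) (r : R) :=
  ((0 < N x)%R%:R * (ratio_pdf r / r ^+ n.+1 * distance_kernel n (N x) r))%:E *
  f (tuple_scale (c * t / (1 + r)) x).
have L0 x r : 0 <= L x r.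
  by rewrite mule_ge0// lee_fin mulr_ge0// mulr_ge0// distance_kernel_ge0// eucl_norm_ge0.
have mL : measurable_fun setT (fun z => L z.1 z.2).
  apply: emeasurable_funM.
    apply/measurable_EFinP; apply: measurable_funM; first by mfun.
    apply: measurable_funM; last by apply: measurable_distance_kernel; mfun.
    apply: measurable_funM; last by mfun.
    by apply: (measurableT_comp mg); mfun.
  by apply: (measurableT_comp mf); mfunt.
pose L' (z : n.+2.-tuple R) (r : R) :=
  f z * ((0 < N z)%R%:R * (ratio_pdf r * two_step_kernel (N z) r))%:E.
have L'0 x r : 0 <= L' x r.
  by rewrite mule_ge0// lee_fin mulr_ge0// mulr_ge0// two_step_kernel_ge0// eucl_norm_ge0.
have mL' : measurable_fun setT (fun z => L' z.1 z.2).
  apply: emeasurable_funM; first exact: (measurableT_comp mf measurable_fst).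
  apply/measurable_EFinP; apply: measurable_funM; first by mfun.
  apply: measurable_funM; last by apply: measurable_two_step_kernel; mfun.
  by apply: (measurableT_comp mg); mfun.
(* At fixed [w1], passing to the ratio r makes (r, [w2]) the polar coordinates of y = r V2. The
   division by N y ^+ n.+1 in [GG] supplies the weight that [polar] requires. *)
transitivity (\int[lam n.+2]_w ((n.+2%:R^-1)%:E * \int[lam n.+2]_y GG w y)).
  apply: eq_integral => w1 _.
  have mGw : measurable_fun setT (GG w1) := measurable_fun_pair2 w1 mGG.
  rewrite -(polar mGw (GG0 w1)).
  apply: eq_integral => w2 _.
  have [W2|W2] := boolP (0 < N w2 < 1)%R; last first.
    rewrite [LHS]integral0_eq ?[RHS]integral0_eq// => r _; first by rewrite mul0r mul0e.
    by rewrite andbF mul0e.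
  have Nw2 : (0 < N w2)%R by case/andP: W2.
  pose fs s := f (tuple_scale c (tuple_add (tuple_scale s (direction w1))
    (tuple_scale (t - s) (direction w2)))).
  have mfs : measurable_fun setT fs by apply: (measurableT_comp mf); mfunt.
  have mgt : measurable_fun setT (fun r : R => fs (t / (1 + r))%R).
    by apply: (measurableT_comp mfs); mfun.
  rewrite andbT ge0_integralZl//; last 2 first.
  - by apply: emeasurable_funM => //; exact/measurable_EFinP.
  - by move=> s _; apply: mule_ge0; [rewrite lee_fin|exact: f0].
  rewrite (integral_ratio mfs (fun=> f0 _)) -ge0_integralZl//; last 2 first.
  - by apply: emeasurable_funM => //; exact/measurable_EFinP.
  - by move=> s _; apply: mule_ge0; [rewrite lee_fin|exact: f0].
  apply: eq_integral => r _; have [r0|r0] := ltP 0%R r; last first.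
    by rewrite ratio_pdf_out// andbF mul0r !mul0e mule0.
  have NE : N (tuple_scale (r / N w2) w2) = r.
    by rewrite eucl_norm_scale ?divr_ge0 ?ltW// divfK// gt_eqF.
  rewrite /GG NE mul1r.
  rewrite !muleA -!EFinM; congr (_%:E * f _).
    by rewrite [RHS]mulrCA (mulrC (r ^+ _)%R) divfK// expf_neq0// gt_eqF.
  have -> : tuple_scale (r / N w2) w2 = tuple_scale r (direction w2).
    by rewrite directionE tuple_scaleA.
  exact: time_ratio_step.
(* Translation of y by the opposite of the first direction: the new variable is x = V1 + y, and the
   ratio N y becomes the distance from x to V1. *)
transitivity (\int[lam n.+2]_w ((n.+2%:R^-1)%:E * \int[lam n.+2]_x K w x)).
  apply: eq_integral => w _; congr (_ * _).
  rewrite -(@integral_tuple_add R _ (GG w) (tuple_scale (-1) (direction w)))//.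
  - apply: eq_integral => x _; rewrite /GG /K /phi muleA -EFinM.
    have -> : tuple_add (tuple_scale (-1) (direction w)) x = D w x.
      by apply: eq_from_tnth => i; rewrite !tnth_mktuple addrC.
    congr (_ * f (tuple_scale _ _)).
    by apply: eq_from_tnth => i; rewrite !tnth_mktuple; ring.
  - exact: (measurable_fun_pair2 w mGG).
rewrite ge0_integralZl ?lee_fin//; last 2 first.
- exact: (@measurable_integral _ _ _ _ _ (lam n.+2) K mK K0).
- by move=> w _; exact: integral_ge0.
rewrite EFinM -muleA; congr (_ * _).
transitivity (\int[lam n.+2]_x \int[lam n.+2]_w K w x).
  by apply: fubini_tonelli_in; [exact: measurableT|exact: measurableT| |].
have mKs : measurable_fun setT (fun z => K z.2 z.1).
  exact: (measurableT_comp mK (measurable_fun_pair measurable_snd measurable_fst)).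
(* The distance law is stated for x of positive norm; the factor introduced here discards the
   origin. *)
rewrite -integral_tuple_neq0; last 2 first.
- exact: (@measurable_integral _ _ _ _ _ (lam n.+2) (fun x w => K w x)).
- by move=> x; exact: integral_ge0.
transitivity (\int[lam n.+2]_x (C'%:E * \int[leb]_r L x r)).
  apply: eq_integral => x _; have [x0|x0] := ltP 0%R (N x); last first.
    rewrite mul0e integral0_eq ?mule0// => r _.
    by rewrite /L ltNge x0 mul0r mul0e.
  rewrite mul1e; have mphix : measurable_fun setT (phi x).
    exact: (measurable_fun_pair2 x mphi).
  rewrite (@integral_distance R n x (phi x) x0 mphix (phi0 x)) Vv -EFinM.
  congr (_ * _); apply: eq_integral => r _.
  by rewrite /phi /L x0 mul1r muleAC -EFinM.
rewrite ge0_integralZl ?lee_fin//; last 2 first.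
- exact: (@measurable_integral _ _ _ _ (measurableTypeR R) leb L mL L0).
- by move=> x _; exact: integral_ge0.
congr (_ * _).
transitivity (\int[leb]_r \int[lam n.+2]_x L x r).
  by apply: fubini_tonelli_in; [exact: measurableT|exact: measurableT| |].
(* At fixed ratio r the dilation x = k z absorbs the prefactor c t / (1 + r) in the argument of [f];
   its Jacobian k ^+ n.+2 is part of [two_step_kernel]. *)
transitivity (\int[leb]_r \int[lam n.+2]_z L' z r).
  apply: eq_integral => r _; have [r0|r0] := ltP 0%R r; last first.
    have g00 := ratio_pdf_out r0.
    rewrite [LHS]integral0_eq ?[RHS]integral0_eq// => x _; rewrite /L /L' g00.
      by rewrite !mul0r mulr0 mule0.
    by rewrite !mul0r mulr0 mul0e.
  pose k := ((1 + r) / (c * t))%R.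
  have k0 : (0 < k)%R by rewrite divr_gt0 ?addr_gt0 ?mulr_gt0.
  have mLr := measurable_fun_pair1 r mL.
  have mLk : measurable_fun setT (fun z : n.+2.-tuple R => L (tuple_scale k z) r).
    by apply: (measurableT_comp mLr); mfunt.
  transitivity ((k ^+ n.+2)%:E * \int[lam n.+2]_z L (tuple_scale k z) r).
    rewrite (integral_tuple_scale k0 mLr (fun=> L0 _ _)) muleA -EFinM divff ?mul1e//.
    by rewrite expf_neq0// gt_eqF.
  rewrite -ge0_integralZl ?lee_fin ?exprn_ge0 ?ltW//.
  apply: eq_integral => z _; rewrite /L /L' eucl_norm_scale ?ltW// pmulr_rgt0//.
  rewrite muleA -EFinM muleC; congr (f _ * _%:E).
    apply: eq_from_tnth => i; rewrite !tnth_mktuple /k.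
    by field; rewrite !gt_eqF// addr_gt0.
  by rewrite /two_step_kernel -/k; ring.
transitivity (\int[lam n.+2]_z \int[leb]_r L' z r).
  by apply/esym/fubini_tonelli_in; [exact: measurableT|exact: measurableT| |].
apply: eq_integral => z _.
have Nz := eucl_norm_ge0 z.
(* Return from the ratio to the duration: at s = t / (1 + r) the argument (t - s) / s of the kernel
   is r again. *)
pose h s := (((0 < N z)%R%:R * two_step_kernel (N z) ((t - s) / s))%:E : \bar R).
have mh : measurable_fun setT h.
  apply/measurable_EFinP; apply: measurable_funM => //.
  by apply: measurable_two_step_kernel; mfun.
have h0 s : 0 <= h s by rewrite lee_fin mulr_ge0// two_step_kernel_ge0.
have := integral_ratio mh h0.
transitivity (f z * \int[leb]_r ((ratio_pdf r)%:E * h (t / (1 + r))%R)).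
  rewrite -ge0_integralZl//; last 2 first.
  - apply: emeasurable_funM; first exact/measurable_EFinP.
    by apply: (measurableT_comp mh); mfun.
  - by move=> r _; rewrite mule_ge0// lee_fin.
  apply: eq_integral => r _; rewrite /L' /h -EFinM; congr (_ * _%:E).
  have [r0|r0] := ltP 0%R r; last by rewrite ratio_pdf_out// !mul0r mulr0.
  have -> : ((t - t / (1 + r)) / (t / (1 + r)) = r)%R.
    by field; rewrite !gt_eqF// addr_gt0.
  by rewrite mulrCA.
rewrite -(integral_ratio mh h0); congr (_ * _); apply: eq_integral => s _.
by rewrite /h -EFinM mulrCA.
Qed.
End fixed_dimension.
End two_steps.

(** * Closed form of the two-step kernel *)

Section kernel_value.
Context (R : realType).
Variables (t c : R) (n : nat).
Hypotheses (t0 : 0 < t) (c0 : 0 < c).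

(** These are the triangle inequalities for sides r, c s and c (t - s), divided by c s. One of them
    bounds r by c t, the other two confine s. *)
Lemma distance_window (r s : R) : 0 < s < t ->
  (`|r / (c * s) - 1| < (t - s) / s < r / (c * s) + 1) =
  (r < c * t) && (t / 2 - r / (2 * c) < s < t / 2 + r / (2 * c)).
Proof.
move=> /andP[s0 st]; have cs0 : 0 < c * s by rewrite mulr_gt0.
pose q := r / c.
have rq : r = c * q by rewrite /q mulrC divfK// gt_eqF.
have -> : r / (c * s) = q / s by rewrite /q; field; rewrite !gt_eqF.
have -> : r / (2 * c) = q / 2 by rewrite /q; field; rewrite !gt_eqF.
rewrite {1}rq ltr_pM2l// ltr_norml.
have -> : q / s - 1 = (q - s) / s by field; rewrite gt_eqF.
have -> : q / s + 1 = (q + s) / s by field; rewrite gt_eqF.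
rewrite -mulNr !ltr_pM2r ?invr_gt0//.
by apply/idP/idP => [/andP[/andP[h1 h2] h3]|/andP[h1 /andP[h2 h3]]];
  apply/andP; split; try (apply/andP; split); lra.
Qed.

(** Heron's formula: in the triangle with sides r, c s and c (t - s), the product [A * B] is sixteen
    times the squared area, and dividing it by (2 c s r)^2 gives the squared sine of the angle
    between the sides r and c s. Both factors are positive by the triangle inequalities, so real
    powers can be distributed over them. *)
Lemma two_step_kernelE (r s : R) : 0 < s < t -> 0 < r ->
  two_step_kernel t c n r ((t - s) / s) =
  ((r < c * t) && (t / 2 - r / (2 * c) < s < t / 2 + r / (2 * c)))%:R *
  (2 * ((c ^+ 2 * t ^+ 2 - r ^+ 2) `^ ((n%:R - 1) / 2) *
        (4 * c ^+ 2 * s * (t - s) - c ^+ 2 * t ^+ 2 + r ^+ 2) `^ ((n%:R - 1) / 2)) /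
   (2 * c ^+ 2 * s * (t - s) * r) ^+ n).
Proof.
move=> st r0; have /andP[s0 s_t] := st; have ts0 : 0 < t - s by rewrite subr_gt0.
have kE : (1 + (t - s) / s) / (c * t) = (c * s)^-1.
  by field; rewrite !gt_eqF.
rewrite /two_step_kernel kE (mulrC _ r) /distance_kernel distance_window//.
have [/andP[rct /andP[s1 s2]]|_] := boolP (_ && _); last by rewrite !mul0r mulr0.
rewrite !mul1r.
set A := c ^+ 2 * t ^+ 2 - r ^+ 2; set B := 4 * c ^+ 2 * s * (t - s) - _ + _.
have A0 : 0 < A.
  by rewrite /A subr_gt0 -exprMn ltrXn2r// ?nnegrE ?mulr_ge0 ?ltW.
have B0 : 0 < B.
  have -> : B = (r - c * (2 * s - t)) * (r + c * (2 * s - t)) by rewrite /B; ring.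
  have -> : r - c * (2 * s - t) = 2 * c * (t / 2 + r / (2 * c) - s).
    by field; rewrite gt_eqF.
  have -> : r + c * (2 * s - t) = 2 * c * (s - (t / 2 - r / (2 * c))).
    by field; rewrite gt_eqF.
  by rewrite !mulr_gt0 ?subr_gt0.
pose q := 2 * c * s * r.
have q0 : 0 < q by rewrite !mulr_gt0.
have -> : 1 - cosine (r / (c * s)) ((t - s) / s) ^+ 2 = A * B / q ^+ 2.
  by rewrite /cosine /A /B /q; field; rewrite !gt_eqF.
have -> : (A * B / q ^+ 2) `^ ((n%:R - 1) / 2) =
    A `^ ((n%:R - 1) / 2) * B `^ ((n%:R - 1) / 2) * (q / q ^+ n).
  rewrite powRM ?mulr_ge0 ?invr_ge0 ?sqr_ge0 ?ltW// powRM ?ltW//; congr (_ * _).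
  rewrite -powR_inv1 ?sqr_ge0// -(powR_mulrn 2) ?ltW// -!powRrM.
  transitivity (q `^ (1 - n%:R)); first by congr (_ `^ _); field.
  rewrite powRB; last by apply/implyP => _; rewrite gt_eqF.
  by rewrite powRr1 ?ltW// powR_mulrn ?ltW.
rewrite /q !exprMn !exprVn !exprMn !exprS.
have E (x : R) : 0 < x -> x ^+ n != 0 by move=> x0; rewrite expf_neq0 ?gt_eqF.
field.
by rewrite ?E ?gt_eqF.
Qed.
End kernel_value.

(** * Uniform law on the sphere and the constants *)

Section sphere.
Local Open Scope ereal_scope.
Context (R : realType) (n : nat).
Local Notation lam n := (lebesgue_tuple R n).
Local Notation N w := (eucl_norm w).

(** By its definition the uniform law is the image under [direction] of the measure with density
    [v^-1] on the punctured ball. *)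
Lemma integral_sphere_uniform (mu : {measure set (n.+1.-tuple R) -> \bar R})
    (v : R) (G : n.+1.-tuple R -> \bar R) :
  lam n.+1 (eucl_ball 1) = v%:E ->
  (forall A, measurable A -> mu A = sphere_uniform A) ->
  measurable_fun setT G -> (forall x, 0 <= G x) ->
  \int[mu]_x G x =
  (v^-1)%:E * \int[lam n.+1]_w ((0 < N w < 1)%R%:R%:E * G (direction w)).
Proof.
move=> Vv muE mG G0.
have v0 : (0 <= v)%R by rewrite -lee_fin -Vv.
have mdir : measurable_fun setT (@direction R n.+1).
  by apply: measurable_direction; mfun.
have mb : measurable_fun setT (fun w : n.+1.-tuple R => (0 < N w < 1)%R) by mfun.
pose g (w : n.+1.-tuple R) : R := (v^-1 * (0 < N w < 1)%R%:R)%R.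
have mg : measurable_fun setT g by rewrite /g; mfun.
have g0 w : (0 <= g w)%R by rewrite mulr_ge0 ?invr_ge0.
have mB : measurable [set w : n.+1.-tuple R | (0 < N w < 1)%R].
  by rewrite -[X in measurable X]setTI; exact: (mb measurableT [set true]).
rewrite (@integral_weighted_image _ _ _ _ _ (lam n.+1) (@direction R n.+1) g
  mdir mg g0 mu)//; last first.
  move=> A mA; have mdA : measurable (@direction R n.+1 @^-1` A).
    by rewrite -[X in measurable X]setTI; exact: mdir.
  rewrite muE// /sphere_uniform Vv/=.
  under [RHS]eq_integral do rewrite /g EFinM.
  rewrite ge0_integralZl ?lee_fin ?invr_ge0//; last first.
    by apply/measurable_EFinP/measurable_funTS; mfun.
  rewrite (_ : [set x | _] = @direction R n.+1 @^-1` A `&` [set w | (0 < N w < 1)%R]);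
    last first.
    apply/seteqP; split => x /=; first by move=> [-> -> ?].
    by move=> [? /andP[? ?]]; split.
  have fin : lam n.+1 (@direction R n.+1 @^-1` A `&` [set w | (0 < N w < 1)%R])
      \is a fin_num.
    rewrite ge0_fin_numE// (@le_lt_trans _ _ v%:E) ?ltry// -Vv.
    rewrite le_measure ?inE//; [exact: measurableI|exact: measurable_eucl_ball|].
    by move=> x [_ /andP[]].
  rewrite mulrC EFinM fineK//; congr (_ * _).
  rewrite -[RHS](_ : \int[lam n.+1]_(x in @direction R n.+1 @^-1` A)
     (\1_[set w : n.+1.-tuple R | (0 < N w < 1)%R] x)%:E = _).
    by rewrite integral_indic// setIC.
  apply: eq_integral => x _; rewrite indicE; congr (_%:R%:E).
  by congr nat_of_bool; apply/idP/idP => [/set_mem//|?]; apply/mem_set.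
rewrite -ge0_integralZl ?lee_fin ?invr_ge0//; last 2 first.
- apply: emeasurable_funM; first by apply/measurable_EFinP; mfun.
  exact: (measurableT_comp mG mdir).
- by move=> w _; rewrite mule_ge0// lee_fin.
by apply: eq_integral => w _; rewrite /g EFinM muleC muleA.
Qed.

End sphere.

(** The left side collects the constants of the computation: [v^-1] for each direction, 1 / (n + 2)
    from [polar], (n + 1) / (n + 2) w from the distance law, 2 / 2^n from [two_step_kernelE]. The
    Gamma values come from [ball_volume] in dimensions n + 2 and n + 1. *)
Lemma sphere_constant (R : realType) n (v w : R) :
  lebesgue_tuple R n.+2 (eucl_ball 1) = v%:E ->
  lebesgue_tuple R n.+1 (eucl_ball 1) = w%:E ->
  v^-1 * v^-1 * (n.+2%:R^-1 * (n.+1%:R / n.+2%:R * w)) * 2 / 2 ^+ n =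
  1 / (2 ^+ n * pi `^ ((n.+2%:R + 1) / 2)) *
  (Gamma (n.+2%:R / 2) ^+ 2 / Gamma (n.+2%:R / 2 - 1 / 2)).
Proof.
move=> Vv Vw.
have [v' + [v0 G0 Ev]] := ball_volume R n.+1; rewrite Vv => -[vv']; rewrite -{v'}vv' in v0 Ev.
have [w' + [w0 G'0 Ew]] := ball_volume R n; rewrite Vw => -[ww']; rewrite -{w'}ww' in w0 Ew.
have -> : n.+2%:R / 2 - 1 / 2 = n.+1%:R / 2 :> R by rewrite -[n.+2%:R]natr1; field.
have piE : pi `^ ((n.+2%:R + 1) / 2) = Num.sqrt pi ^+ n.+3 :> R.
  rewrite natr1 mulrC -[_^-1 * _]/(2^-1 * n.+3%:R) powRrM powR12_sqrt ?pi_ge0//.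
  by rewrite powR_mulrn// sqrtr_ge0.
rewrite piE.
set G := Gamma (n.+2%:R / 2) in G0 Ev *; set G' := Gamma (n.+1%:R / 2) in G'0 Ew *.
have s0 : 0 < Num.sqrt pi :> R by rewrite sqrtr_gt0 pi_gt0.
have -> : v = 2 * Num.sqrt pi ^+ n.+2 / (n.+2%:R * G).
  by rewrite -Ev; field; rewrite gt_eqF//= addrC natr1 pnatr_eq0.
have -> : w = 2 * Num.sqrt pi ^+ n.+1 / (n.+1%:R * G').
  by rewrite -Ew; field; rewrite gt_eqF//= addrC natr1 pnatr_eq0.
rewrite !exprS.
field.
rewrite !expf_neq0 ?gt_eqF//=.
Qed.

Lemma Gamma_ge0 (R : realType) (x : R) : 0 <= Gamma x.
Proof. by apply: Rintegral_ge0 => y _; rewrite mulr_ge0 ?powR_ge0 ?expR_ge0. Qed.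

Ltac nonneg := repeat first [done | rewrite invr_ge0 | exact: Gamma_ge0
  | exact: powR_ge0 | apply: exprn_ge0 | apply: mulr_ge0 | exact: ltW].

(** * Evaluation of the density *)

Section density_value.
Context (R : realType).
Local Notation leb := (@lebesgue_measure R).
Local Notation lam n := (lebesgue_tuple R n).
Local Notation N w := (eucl_norm w).
Variables (t c a b : R) (n : nat).
Hypotheses (t0 : 0 < t) (c0 : 0 < c).

Lemma rescaled_beta_pdf_ge0 s : 0 <= rescaled_beta_pdf t a b s.
Proof.
rewrite /rescaled_beta_pdf; case: ifPn => // _.
by rewrite mulr_ge0 ?divr_ge0 ?mulr_ge0 ?powR_ge0 ?Gamma_ge0.
Qed.

Lemma rescaled_beta_pdf_out s : s \notin `]0, t[ -> rescaled_beta_pdf t a b s = 0.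
Proof. by rewrite /rescaled_beta_pdf => /negbTE ->. Qed.

Definition p1_factor (r : R) : R :=
  1 / (2 ^+ n * pi `^ ((n.+2%:R + 1) / 2)) *
  (Gamma (n.+2%:R / 2) ^+ 2 / Gamma (n.+2%:R / 2 - 1 / 2)) *
  (Gamma (a + b) / (Gamma a * Gamma b)) * (1 / t `^ (a + b - 1)) *
  ((c ^+ 2 * t ^+ 2 - r ^+ 2) `^ ((n.+2%:R - 3) / 2) / (r ^+ n * c ^+ (2 * n))).

Definition p1_integrand (r s : R) : R :=
  s `^ (a - n.+2%:R + 1) * (t - s) `^ (b - n.+2%:R + 1) *
  (4 * c ^+ 2 * s * (t - s) - c ^+ 2 * t ^+ 2 + r ^+ 2) `^ ((n.+2%:R - 3) / 2).

(** Kept in [\bar R], so that it can be compared with [law_density] before anything is known about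
    finiteness. *)
Definition p1_integral (r : R) : \bar R :=
  (\int[leb]_(s in `[(t / 2 - r / (2 * c))%R, (t / 2 + r / (2 * c))%R])
     (p1_integrand r s)%:E)%E.

Lemma p1E (x : n.+2.-tuple R) :
  p1 c t a b x = p1_factor (N x) * fine (p1_integral (N x)).
Proof.
rewrite /p1 /p1_factor /p1_integral /Rintegral subn2/=.
by rewrite (_ : (2 * n.+2 - 4 = 2 * n)%N)// !mulnS addnA addKn.
Qed.

Lemma p1_integrand_ge0 r s : 0 <= p1_integrand r s.
Proof. by rewrite !mulr_ge0 ?powR_ge0. Qed.

Lemma p1_integral_ge0 r : (0 <= p1_integral r)%E.
Proof. by apply: integral_ge0 => s _; rewrite lee_fin p1_integrand_ge0. Qed.

Lemma p1_factor_ge0 r : 0 <= r -> 0 <= p1_factor r.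
Proof.
by move=> r0; rewrite /p1_factor; nonneg.
Qed.

Lemma measurable_p1 : measurable_fun setT (@p1 R n.+2 c t a b).
Proof.
have -> : @p1 R n.+2 c t a b = fun x => p1_factor (N x) * fine (p1_integral (N x)).
  by apply/funext => x; exact: p1E.
apply: measurable_funM; first by rewrite /p1_factor; mfun.
have mI : measurable_fun setT p1_integral.
  pose K (r s : R) : \bar R := ((t / 2 - r / (2 * c) <= s <= t / 2 + r / (2 * c))%R%:R *
    p1_integrand r s)%:E.
  have -> : p1_integral = fun r => (\int[leb]_s K r s)%E.
    apply/funext => r; rewrite /p1_integral.
    rewrite (integral_mkbool leb (fun s => s \in `[t / 2 - r / (2 * c), t / 2 + r / (2 * c)])).
    by apply: eq_integral => s _; rewrite in_itv/= -EFinM.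
  apply: (@measurable_integral _ _ _ R (measurableTypeR R) leb K).
    by apply/measurable_EFinP; rewrite /p1_integrand; mfun.
  by move=> r s; rewrite lee_fin mulr_ge0// p1_integrand_ge0.
have mIN : measurable_fun setT (fun x : n.+2.-tuple R => p1_integral (N x)).
  by apply: (measurableT_comp mI); mfun.
by apply: measurableT_comp mIN; exact: fine_measurable.
Qed.

Section value.
Variables (v w : R).
Hypotheses (Vv : lam n.+2 (eucl_ball 1) = v%:E) (Vw : lam n.+1 (eucl_ball 1) = w%:E).

(** The density as it comes out of [two_steps], with the normalizations of both uniform laws
    included. *)
Definition law_density (r : R) : \bar R :=
  ((v^-1 * v^-1 * (n.+2%:R^-1 * (n.+1%:R / n.+2%:R * w)))%:E *
   \int[leb]_s ((0 < r)%R%:R * (rescaled_beta_pdf t a b s *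
                                two_step_kernel t c n r ((t - s) / s)))%:E)%E.

Lemma law_density_in r : 0 < r -> r < c * t ->
  law_density r = ((p1_factor r)%:E * p1_integral r)%E.
Proof.
move=> r0 rct.
pose G := Gamma (a + b) / (Gamma a * Gamma b).
pose q := G / t `^ (a + b - 1) * 2 / 2 ^+ n *
  ((c ^+ 2 * t ^+ 2 - r ^+ 2) `^ ((n.+2%:R - 3) / 2) / (r ^+ n * c ^+ (2 * n))).
have mI : measurable_fun setT (p1_integrand r) by rewrite /p1_integrand; mfun.
have q0 : 0 <= q by rewrite /q /G; nonneg.
(* At the endpoints the bracket of the integrand vanishes; they form a null set, and the kernel
   lives on the open interval. *)
have -> : p1_integral r = (\int[leb]_(s in
    `](t / 2 - r / (2 * c))%R, (t / 2 + r / (2 * c))%R[) (p1_integrand r s)%:E)%E.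
  by rewrite /p1_integral integral_itv_bndoo//; exact/measurable_EFinP/measurable_funTS.
(* The window of integration therefore lies inside ]0, t[, and the support of the Beta density does
   not truncate it. *)
have rct' : r / (2 * c) < t / 2.
  rewrite ltr_pdivrMr ?mulr_gt0// (_ : t / 2 * (2 * c) = c * t)//; by field.
rewrite /law_density r0.
transitivity ((v^-1 * v^-1 * (n.+2%:R^-1 * (n.+1%:R / n.+2%:R * w)))%:E *
  (q%:E * (\int[leb]_(s in
    `](t / 2 - r / (2 * c))%R, (t / 2 + r / (2 * c))%R[) (p1_integrand r s)%:E)))%E.
  congr (_ * _)%E; rewrite -ge0_integralZl ?lee_fin//; last 2 first.
  - exact/measurable_EFinP/measurable_funTS.
  - by move=> s _; rewrite lee_fin p1_integrand_ge0.
  rewrite (integral_mkbool leb (fun s => s \in `](t / 2 - r / (2 * c)), (t / 2 + r / (2 * c))[)).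
  apply: eq_integral => s _; rewrite mul1r -!EFinM; congr (_%:E).
  have [st|st] := boolP (0 < s < t); last first.
    rewrite rescaled_beta_pdf_out ?in_itv//= mul0r.
    have -> : (t / 2 - r / (2 * c) < s < t / 2 + r / (2 * c)) = false.
      by apply/negbTE; apply: contra st => /andP[s1 s2]; apply/andP; split; lra.
    by rewrite mul0r.
  have /andP[s0 s_t] := st; have ts0 : 0 < t - s by rewrite subr_gt0.
  rewrite two_step_kernelE// rct /rescaled_beta_pdf !in_itv/= st.
  rewrite mulrCA; congr (_ * _).
  rewrite /q /p1_integrand.
  have eE : (n.+2%:R - 3) / 2 = (n%:R - 1) / 2 :> R.
    by congr (_ / _); rewrite -[n.+2%:R]natr1 -[n.+1%:R]natr1; ring.
  rewrite eE.
  (* The exponent p - d + 1 of the statement is the Beta exponent p - 1 lowered by n, from the n-th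
     power in the denominator of the kernel. *)
  have sE (x p : R) : 0 < x -> x `^ (p - n.+2%:R + 1) = x `^ (p - 1) / x ^+ n.
    move=> x0; rewrite (_ : p - _ + 1 = p - 1 - n%:R); last first.
      by rewrite -[n.+2%:R]natr1 -[n.+1%:R]natr1; ring.
    rewrite powRB; last by apply/implyP => _; rewrite gt_eqF.
    by rewrite powR_mulrn// ltW.
  rewrite !sE// mul2n -addnn exprD !exprMn -/G.
  field.
  by rewrite !expf_neq0 ?gt_eqF ?powR_gt0.
rewrite muleA -EFinM; congr (_%:E * _)%E.
rewrite /q /p1_factor -/G -(sphere_constant Vv Vw).
have [v' + [v0 _ _]] := ball_volume R n.+1; rewrite Vv => -[vv']; rewrite -vv' in v0.
by field; rewrite !expf_neq0 ?gt_eqF ?powR_gt0//=.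
Qed.

Lemma law_density_out r : ~~ (0 < r < c * t) -> law_density r = 0%E.
Proof.
rewrite /law_density; have [r0|_] := ltP 0 r => /= rct; last first.
  by rewrite integral0_eq ?mule0// => s _; rewrite mul0r.
rewrite integral0_eq ?mule0// => s _; have [st|st] := boolP (0 < s < t); last first.
  by rewrite rescaled_beta_pdf_out ?in_itv//= mul0r mulr0.
by rewrite two_step_kernelE// (negbTE rct) !mul0r !mulr0.
Qed.
End value.
End density_value.

(** * Joint law of the directions and the duration *)

Section independence.
Local Open Scope ereal_scope.
Context (R : realType) d (Omega : measurableType d) (P : probability Omega R).
Context d1 d2 d3 d4 (T1 : measurableType d1) (T2 : measurableType d2)
  (T3 : measurableType d3) (T4 : measurableType d4).
Variables (X1 : {RV P >-> T1}) (X2 : {RV P >-> T2}) (X3 : {RV P >-> T3})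
  (X4 : {RV P >-> T4}).
Hypothesis indep : mutually_independent P
  [tuple sigma_of X1; sigma_of X2; sigma_of X3; sigma_of X4].

Lemma independent4 A1 A2 A3 A4 : measurable A1 -> measurable A2 ->
  measurable A3 -> measurable A4 ->
  P (X1 @^-1` A1 `&` (X2 @^-1` A2 `&` (X3 @^-1` A3 `&` X4 @^-1` A4))) =
  P (X1 @^-1` A1) * (P (X2 @^-1` A2) * (P (X3 @^-1` A3) * P (X4 @^-1` A4))).
Proof.
move=> mA1 mA2 mA3 mA4.
pose E := [tuple X1 @^-1` A1; X2 @^-1` A2; X3 @^-1` A3; X4 @^-1` A4].
have := @indep (finset.setTfor 'I_4) (tnth E) _.
rewrite big_mkcond/= !big_ord_recr big_ord0/= !inE mul1e -!muleA => <-.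
- congr (P _); apply/seteqP; split => w /=.
    move=> [w1 [w2 [w3 w4]]] i _.
    by case: i => -[|[|[|[|//]]]] i4.
  move=> H; split; [|split; [|split]].
  + by apply: (H (@Ordinal 4 0 isT)); rewrite /= inE.
  + by apply: (H (@Ordinal 4 1 isT)); rewrite /= inE.
  + by apply: (H (@Ordinal 4 2 isT)); rewrite /= inE.
  + by apply: (H (@Ordinal 4 3 isT)); rewrite /= inE.
- have sX d' (T' : measurableType d') (X : {RV P >-> T'}) A :
    measurable A -> sigma_of X (X @^-1` A).
    by move=> mA; exists A; rewrite ?setTI.
  by move=> -[[|[|[|[|//]]]] i4] _; exact: sX.
Qed.

(* [\x] yields a plain measure, without the sigma-finiteness that an outer
   product needs. *)
Local Notation law23 := (product_subprobability
  (distribution P X2 : subprobability T2 R, distribution P X3 : subprobability T3 R)).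

Lemma independent_joint_law C A4 : measurable C -> measurable A4 ->
  P ([set w | C (X1 w, (X2 w, X3 w))] `&` X4 @^-1` A4) =
  P (X4 @^-1` A4) *
  (distribution P X1 \x law23) C.
Proof.
move=> mC mA4.
have mpre d' (T' : measurableType d') (X : {RV P >-> T'}) A : measurable A ->
    measurable (X @^-1` A).
  by move=> mA; rewrite -[_ @^-1` _]setTI; exact: measurable_funP.
have mX4 := mpre _ _ X4 _ mA4.
have fP A : measurable A -> (fine (P A))%:E = P A.
  by move=> mA; rewrite fineK// fin_num_measure.
have step A1 B : measurable A1 -> measurable B ->
    P ([set w | B (X2 w, X3 w)] `&` (X1 @^-1` A1 `&` X4 @^-1` A4)) =
    P (X1 @^-1` A1) * P (X4 @^-1` A4) *
    law23 B.
  move=> mA1 mB; have mX1 := mpre _ _ X1 _ mA1.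
  have mD : measurable (X1 @^-1` A1 `&` X4 @^-1` A4) by exact: measurableI.
  have := @product_law _ _ _ _ _ _ R (mrestr P mD) (distribution P X2)
    (distribution P X3) (fine (P (X1 @^-1` A1)) * fine (P (X4 @^-1` A4)))%R X2 X3.
  rewrite EFinM !fP// => <- //.
  - by rewrite mulr_ge0// fine_ge0.
  - move=> A2 A3 mA2 mA3; rewrite /= /mrestr.
    rewrite (_ : _ `&` _ = X1 @^-1` A1 `&` (X2 @^-1` A2 `&` (X3 @^-1` A3 `&` X4 @^-1` A4))).
      rewrite independent4// /distribution /pushforward.
      by rewrite -!muleA; congr (_ * _); rewrite [RHS]muleC muleA.
    by apply/seteqP; split => w /=; tauto.
have := @product_law _ _ _ _ _ _ R (mrestr P mX4) (distribution P X1)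
    law23 (fine (P (X4 @^-1` A4))) X1
    (fun w => (X2 w, X3 w)).
rewrite !fP// => <- //.
- exact: measurable_fun_pair.
- by rewrite fine_ge0.
- move=> A B mA mB; rewrite /= /mrestr.
  rewrite (_ : _ `&` _ = [set w | B (X2 w, X3 w)] `&` (X1 @^-1` A `&` X4 @^-1` A4)).
    by rewrite step// /distribution /pushforward muleCA muleA.
  by apply/seteqP; split => w /=; tauto.
Qed.
End independence.

(** * Law of the position *)

Section position_map.
Local Open Scope ereal_scope.
Context (R : realType) (n : nat).
Local Notation leb := (@lebesgue_measure R).
Local Notation lam n := (lebesgue_tuple R n).
Local Notation N w := (eucl_norm w).
Local Notation T := (n.+2.-tuple R).
Variables (t c a b v w : R).
Hypotheses (t0 : (0 < t)%R) (c0 : (0 < c)%R).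
Hypotheses (Vv : lam n.+2 (eucl_ball 1) = v%:E) (Vw : lam n.+1 (eucl_ball 1) = w%:E).
Variables (m1 m2 : probability T R) (m3 : probability R R).
Hypotheses (m1E : forall A, measurable A -> m1 A = sphere_uniform A)
  (m2E : forall A, measurable A -> m2 A = sphere_uniform A)
  (m3E : has_density leb m3 (rescaled_beta_pdf t a b)).

Definition position (z : T * (T * R)) : T :=
  tuple_scale c (tuple_add (tuple_scale z.2.2 z.1) (tuple_scale (t - z.2.2) z.2.1)).

Lemma measurable_position : measurable_fun setT position.
Proof. by rewrite /position; mfunt; do ? apply: measurableT_comp. Qed.

Lemma integral_sphere_pair (H : T -> T -> \bar R) :
  measurable_fun setT (fun z : T * T => H z.1 z.2) -> (forall x y, 0 <= H x y) ->
  \int[m1]_x \int[m2]_y H x y = (v^-1 * v^-1)%:E *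
  \int[lam n.+2]_x \int[lam n.+2]_y
    (((0 < N x < 1) && (0 < N y < 1))%R%:R%:E * H (direction x) (direction y)).
Proof.
move=> mH H0.
have v0 : (0 <= v)%R by rewrite -lee_fin -Vv.
have mdir : measurable_fun setT (@direction R n.+2).
  by apply: measurable_direction; mfun.
have mb (V : T -> R) : measurable_fun setT V -> measurable_fun setT (fun y => (V y)%:E).
  by move=> mV; exact/measurable_EFinP.
pose W (x : T) : R := (0 < N x < 1)%R%:R.
have mW : measurable_fun setT W by rewrite /W; mfun.
have W0 x : 0 <= (W x)%:E by rewrite lee_fin.
have mHx x : measurable_fun setT (H x) by exact: (measurable_fun_pair2 x mH).
pose K x := \int[lam n.+2]_y ((W y)%:E * H x (direction y)).
have mK : measurable_fun setT K.
  apply: (@measurable_integral _ _ _ _ _ (lam n.+2) (fun x y => (W y)%:E * H x (direction y))).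
    apply: emeasurable_funM.
      by apply/measurable_EFinP; exact: (measurableT_comp mW measurable_snd).
    apply: (measurableT_comp mH (_ : measurable_fun setT
      (fun z : T * T => (z.1, direction z.2)))).
    by apply: measurable_fun_pair => //; exact: (measurableT_comp mdir measurable_snd).
  by move=> x y; rewrite mule_ge0.
have K0 x : 0 <= K x by apply: integral_ge0 => y _; rewrite mule_ge0.
transitivity (\int[m1]_x ((v^-1)%:E * K x)).
  by apply: eq_integral => x _; rewrite (integral_sphere_uniform Vv m2E (mHx x)).
rewrite (integral_sphere_uniform Vv m1E); last 2 first.
- by apply: emeasurable_funM.
- by move=> x; rewrite mule_ge0// lee_fin invr_ge0.
rewrite EFinM -muleA; congr (_ * _).
rewrite -ge0_integralZl ?lee_fin ?invr_ge0//; last 2 first.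
- have : measurable_fun setT (fun x : T => \int[lam n.+2]_y
    ((W x)%:E * ((W y)%:E * H (direction x) (direction y)))).
    apply: (@measurable_integral _ _ _ _ _ (lam n.+2) (fun x y =>
      (W x)%:E * ((W y)%:E * H (direction x) (direction y)))).
      apply: emeasurable_funM.
        by apply/measurable_EFinP; exact: (measurableT_comp mW measurable_fst).
      apply: emeasurable_funM.
        by apply/measurable_EFinP; exact: (measurableT_comp mW measurable_snd).
      apply: (measurableT_comp mH (_ : measurable_fun setT
        (fun z : T * T => (direction z.1, direction z.2)))).
      by apply: measurable_fun_pair;
        [exact: (measurableT_comp mdir measurable_fst)
        |exact: (measurableT_comp mdir measurable_snd)].
    by move=> x y; rewrite !mule_ge0.
  congr (measurable_fun _ _); apply/funext => x; apply: eq_integral => y _.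
  by rewrite /W muleA -EFinM -natrM mulnb.
- by move=> x _; apply: integral_ge0 => y _; rewrite mule_ge0// lee_fin.
apply: eq_integral => x _; rewrite -/(W x) muleCA; congr (_ * _).
rewrite -ge0_integralZl//; last 2 first.
- apply: emeasurable_funM; first exact: mb.
  exact: (measurableT_comp (mHx _) mdir).
- by move=> y _; rewrite mule_ge0.
apply: eq_integral => y _.
by rewrite /W muleA -EFinM -natrM mulnb.
Qed.

End position_map.

Section law.
Local Open Scope ereal_scope.
Context (R : realType) (n : nat).
Local Notation leb := (@lebesgue_measure R).
Local Notation lam n := (lebesgue_tuple R n).
Local Notation N w := (eucl_norm w).
Local Notation T := (n.+2.-tuple R).
Variables (t c a b v w : R).
Hypotheses (t0 : (0 < t)%R) (c0 : (0 < c)%R).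
Hypotheses (Vv : lam n.+2 (eucl_ball 1) = v%:E) (Vw : lam n.+1 (eucl_ball 1) = w%:E).
Variables (m1 m2 : probability T R) (m3 : probability R R).
Hypotheses (m1E : forall A, measurable A -> m1 A = sphere_uniform A)
  (m2E : forall A, measurable A -> m2 A = sphere_uniform A)
  (m3E : has_density leb m3 (rescaled_beta_pdf t a b)).

Lemma measurable_two_step_mixture : measurable_fun setT (rescaled_beta_pdf t a b) ->
  measurable_fun setT (fun x : T => \int[leb]_s ((0 < N x)%R%:R *
    (rescaled_beta_pdf t a b s * two_step_kernel t c n (N x) ((t - s) / s)))%:E).
Proof.
move=> mbeta.
apply: (@measurable_integral _ _ _ _ (measurableTypeR R) leb (fun (x : T) s =>
  ((0 < N x)%R%:R * (rescaled_beta_pdf t a b s *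
    two_step_kernel t c n (N x) ((t - s) / s)))%:E)); last first.
  move=> x s; rewrite lee_fin mulr_ge0// mulr_ge0 ?rescaled_beta_pdf_ge0//.
  by rewrite two_step_kernel_ge0// eucl_norm_ge0.
apply/measurable_EFinP; apply: measurable_funM; first by mfun.
apply: measurable_funM; first exact: (measurableT_comp mbeta measurable_snd).
by apply: measurable_two_step_kernel; mfun.
Qed.

Lemma measurable_law_density : measurable_fun setT (rescaled_beta_pdf t a b) ->
  measurable_fun setT (fun x : T => law_density t c a b n v w (N x)).
Proof.
by move=> mbeta; apply: emeasurable_funM => //; exact: measurable_two_step_mixture.
Qed.

Lemma position_law A : measurable A ->
  (m1 \x product_subprobability (m2 : subprobability T R, m3 : subprobability R R))
    (position t c @^-1` A) =
  \int[lam n.+2]_(x in A) law_density t c a b n v w (N x).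
Proof.
move=> mA; have [mbeta beta0 betaE] := m3E.
have mpos := @measurable_position R n t c.
have mposA : measurable (position t c @^-1` A).
  by rewrite -[X in measurable X]setTI; exact: mpos.
have mi : measurable_fun setT (\1_A : T -> R) by exact: measurable_indic.
pose F (x1 x2 : T) (s : R) : \bar R := (\1_A (position t c (x1, (x2, s))))%:E.
have mF : measurable_fun setT (fun z : T * (T * R) => F z.1 z.2.1 z.2.2).
  apply/measurable_EFinP.
  rewrite (_ : (fun z => _) = \1_A \o position t c); last by apply/funext => -[? [? ?]].
  exact: (measurableT_comp mi mpos).
have F0 x1 x2 s : 0 <= F x1 x2 s by rewrite lee_fin.
have mF2 x1 : measurable_fun setT (fun z : T * R => F x1 z.1 z.2).
  apply: (measurableT_comp mF (_ : measurable_fun setT (fun z : T * R => (x1, z)))).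
  exact: measurable_fun_pair.
have mFs x1 x2 : measurable_fun setT (F x1 x2).
  apply: (measurableT_comp (mF2 x1) (_ : measurable_fun setT (fun s : R => (x2, s)))).
  exact: measurable_fun_pair.
transitivity (\int[m1]_x1 \int[m2]_x2 \int[m3]_s F x1 x2 s).
  rewrite -[LHS](_ : \int[m1 \x product_subprobability
      (m2 : subprobability T R, m3 : subprobability R R)]_z F z.1 z.2.1 z.2.2 = _).
    transitivity (\int[m1]_x1 \int[product_subprobability
      (m2 : subprobability T R, m3 : subprobability R R)]_y F x1 y.1 y.2).
      exact: fubini_tonelli1.
    by apply: eq_integral => x1 _; apply: (@fubini_tonelli1 _ _ _ _ _ m2 m3).
  rewrite -[RHS](_ : \int[m1 \x product_subprobability
      (m2 : subprobability T R, m3 : subprobability R R)]_z (\1_(position t c @^-1` A) z)%:E = _).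
    by apply: eq_integral => -[? [? ?]] _; rewrite /F !indicE.
  by rewrite (integral_indic _ measurableT mposA) setIT.
transitivity (\int[m1]_x1 \int[m2]_x2 \int[leb]_s ((rescaled_beta_pdf t a b s)%:E * F x1 x2 s)).
  apply: eq_integral => x1 _; apply: eq_integral => x2 _.
  (* The law of the duration is the weighted image of Lebesgue measure under the identity. *)
  rewrite (@integral_weighted_image _ _ (measurableTypeR R) R R leb (@id R)
    (rescaled_beta_pdf t a b) (@measurable_id _ _ _) mbeta beta0 m3)//.
  by apply: eq_integral => s _; rewrite muleC.
have bF0 x1 x2 s : 0 <= (rescaled_beta_pdf t a b s)%:E * F x1 x2 s.
  by apply: mule_ge0; rewrite lee_fin.
have mbF : measurable_fun setT (fun z : T * T * measurableTypeR R =>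
    (rescaled_beta_pdf t a b z.2)%:E * F z.1.1 z.1.2 z.2).
  apply: emeasurable_funM.
    by apply/measurable_EFinP; exact: (measurableT_comp mbeta measurable_snd).
  apply: (measurableT_comp mF (_ : measurable_fun setT
    (fun z : T * T * measurableTypeR R => (z.1.1, (z.1.2, z.2 : R))))).
  apply: measurable_fun_pair; first by apply: measurableT_comp.
  by apply: measurable_fun_pair; first by apply: measurableT_comp.
rewrite (integral_sphere_pair Vv m1E m2E (H := fun x1 x2 => \int[leb]_s
    ((rescaled_beta_pdf t a b s)%:E * F x1 x2 s))); last 2 first.
- exact: (@measurable_integral _ _ _ _ (measurableTypeR R) leb (fun (z : T * T) s =>
    (rescaled_beta_pdf t a b s)%:E * F z.1 z.2 s)).
- by move=> x y; exact: integral_ge0.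
have mEi : measurable_fun setT (fun z : T => (\1_A z : R)%:E) by exact/measurable_EFinP.
have Ei0 (z : T) : 0 <= (\1_A z : R)%:E by rewrite lee_fin.
have := two_steps t0 c0 mbeta beta0 (@rescaled_beta_pdf_out R t a b) mEi Ei0.
rewrite Vw => two.
transitivity ((v^-1 * v^-1)%:E * ((n.+2%:R^-1)%:E * ((n.+1%:R / n.+2%:R)%:E * w%:E) *
    \int[lam n.+2]_z ((\1_A z : R)%:E * \int[leb]_s
      ((0 < N z)%R%:R * (rescaled_beta_pdf t a b s *
        two_step_kernel t c n (N z) ((t - s) / s)))%:E))).
  rewrite -two; congr (_ * _).
  apply: eq_integral => x1 _; apply: eq_integral => x2 _.
  rewrite -ge0_integralZl// ?lee_fin//.
  exact: (measurable_fun_pair2 (direction x1, direction x2) mbF).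
have [v' + [v0 _ _]] := ball_volume R n.+1; rewrite Vv => -[vv']; rewrite -{v'}vv' in v0.
have [w' + [w0 _ _]] := ball_volume R n; rewrite Vw => -[ww']; rewrite -{w'}ww' in w0.
rewrite muleA [RHS]integral_mkcond.
pose J (z : T) := \int[leb]_s ((0 < N z)%R%:R * (rescaled_beta_pdf t a b s *
  two_step_kernel t c n (N z) ((t - s) / s)))%:E.
have J0 z : 0 <= J z.
  apply: integral_ge0 => s _; rewrite lee_fin mulr_ge0// mulr_ge0//.
  by rewrite two_step_kernel_ge0// eucl_norm_ge0.
have mJ : measurable_fun setT J by exact: measurable_two_step_mixture.
rewrite -!EFinM -ge0_integralZl.
- apply: eq_integral => z _; rewrite -/(J z) patchE indicE /law_density -/(J z).
  by case: ifP => _; rewrite ?mul1e ?mul0e ?mule0.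
- exact: measurableT.
- by apply: emeasurable_funM.
- by move=> z _; rewrite mule_ge0//; exact: J0.
- by rewrite lee_fin; do ! rewrite mulr_ge0 ?invr_ge0//; exact: ltW.
Qed.
End law.

(** * From the extended density to the real one *)

Section density.
Local Open Scope ereal_scope.
Context (R : realType) (n : nat).
Local Notation leb := (@lebesgue_measure R).
Local Notation lam n := (lebesgue_tuple R n).
Local Notation N w := (eucl_norm w).
Local Notation T := (n.+2.-tuple R).
Variables (t c a b v w : R).
Hypotheses (t0 : (0 < t)%R) (c0 : (0 < c)%R).
Hypotheses (Vv : lam n.+2 (eucl_ball 1) = v%:E) (Vw : lam n.+1 (eucl_ball 1) = w%:E).

Lemma eucl_norm_neq0_ae : {ae lam n.+2, forall x, (0 < N x)%R}.
Proof.
have mb : measurable_fun setT (fun x : T => (0 < N x)%R) by mfun.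
have mB : measurable [set x : T | ~~ (0 < N x)%R].
  rewrite (_ : [set x : T | _] = setT `&` (fun x : T => (0 < N x)%R) @^-1` [set false]).
    exact: (mb measurableT [set false]).
  by rewrite setTI; apply/seteqP; split => x /=; [exact: negbTE|move=> ->].
exists [set x : T | ~~ (0 < N x)%R]; split; [exact: mB| |by move=> x /= /negP].
rewrite -[X in lam n.+2 X]setIT -(integral_indic _ measurableT mB).
rewrite -integral_tuple_neq0//.
- apply: integral0_eq => x _; rewrite indicE; have [x0|x0] := ltP 0%R (N x).
    by rewrite memNset ?mule0//= x0.
  by rewrite mul0e.
- by apply/measurable_EFinP; exact: measurable_indic.
Qed.

Lemma law_density_ge0 r : (0 <= r)%R -> 0 <= law_density t c a b n v w r.
Proof.
move=> r0.
have [v' + [v0 _ _]] := ball_volume R n.+1; rewrite Vv => -[vv']; rewrite -{v'}vv' in v0.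
have [w' + [w0 _ _]] := ball_volume R n; rewrite Vw => -[ww']; rewrite -{w'}ww' in w0.
apply: mule_ge0.
  by rewrite lee_fin; do ! rewrite mulr_ge0 ?invr_ge0//; exact: ltW.
apply: integral_ge0 => s _; rewrite lee_fin mulr_ge0// mulr_ge0 ?rescaled_beta_pdf_ge0//.
by rewrite two_step_kernel_ge0.
Qed.

Definition position_pdf (x : T) : R :=
  if x \in eucl_ball (c * t) then p1 c t a b x else 0%R.

Lemma position_pdf_ge0 x : (0 <= position_pdf x)%R.
Proof.
rewrite /position_pdf; case: ifP => // _.
by rewrite p1E mulr_ge0 ?fine_ge0 ?p1_integral_ge0 ?p1_factor_ge0 ?eucl_norm_ge0.
Qed.

Lemma measurable_position_pdf : measurable_fun setT position_pdf.
Proof.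
rewrite (_ : position_pdf = fun x => if (N x < c * t)%R then p1 c t a b x else 0%R).
  apply: measurable_fun_ifT => //; [by mfun|exact: measurable_p1].
apply/funext => x; rewrite /position_pdf; congr (if _ then _ else _).
by apply/idP/idP => [/set_mem//|?]; apply/mem_set.
Qed.

Lemma law_density_position_pdf (x : T) : (0 < N x)%R ->
  law_density t c a b n v w (N x) \is a fin_num ->
  law_density t c a b n v w (N x) = (position_pdf x)%:E.
Proof.
move=> x0; rewrite /position_pdf.
have -> : (x \in eucl_ball (c * t)) = (N x < c * t)%R.
  by apply/idP/idP => [/set_mem//|?]; apply/mem_set.
have [xct|xct] := ltP (N x) (c * t)%R; last first.
  by rewrite law_density_out// ?x0/= -leNgt.
rewrite (law_density_in a b t0 c0 Vv Vw)// p1E.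
move: (p1_factor_ge0 t a b n c0 (ltW x0)) (p1_integral_ge0 t c a b n (N x)).
move: (p1_factor _ _ _ _ _ _) (p1_integral _ _ _ _ _ _) => f [r||]// f0 _.
(* Only the value +oo of the integral is left. Its [fine] is 0, and finiteness of the product forces
   the factor [f] to be 0, so both sides vanish. *)
have [->|f1] := eqVneq f 0%R; first by rewrite mul0e mul0r.
by rewrite mulry gtr0_sg ?mul1e// lt_neqAle eq_sym f1.
Qed.

(** A finite total integral makes [law_density] finite almost everywhere, and off the origin, which
    is null, a finite value is the real density. *)
Lemma integral_law_density A : measurable_fun setT (rescaled_beta_pdf t a b) ->
  \int[lam n.+2]_x law_density t c a b n v w (N x) < +oo -> measurable A ->
  \int[lam n.+2]_(x in A) law_density t c a b n v w (N x) =
  \int[lam n.+2]_(x in A) (position_pdf x)%:E.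
Proof.
move=> mbeta fin mA.
have mL : measurable_fun setT (fun x : T => law_density t c a b n v w (N x)).
  exact: measurable_law_density.
have L0 x : 0 <= law_density t c a b n v w (N x).
  by rewrite law_density_ge0 ?eucl_norm_ge0.
apply: ge0_ae_eq_integral => //.
- exact: measurable_funTS.
- by apply/measurable_EFinP/measurable_funTS; exact: measurable_position_pdf.
- by move=> x _; rewrite lee_fin position_pdf_ge0.
have : (lam n.+2).-integrable setT (fun x => law_density t c a b n v w (N x)).
  apply/integrableP; split=> //.
  by under eq_integral do rewrite gee0_abs//.
move=> /(integrable_ae measurableT).
apply: filterS2 eucl_norm_neq0_ae => x x0 Lx _.
by apply: law_density_position_pdf => //; exact: Lx.
Qed.
End density.

Theorem theorem2 (R : realType) (disp : measure_display)
    (Omega : measurableType disp) (P : probability Omega R)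
    (d : nat) (t c a1 b1 : R)
    (N : {RV P >-> nat}) (V1 V2 : {RV P >-> d.-tuple R}) (tau1 : {RV P >-> R})
    (X : {RV P >-> d.-tuple R}) :
  (2 <= d)%N -> 0 < t -> 0 < c -> 0 < a1 -> 0 < b1 ->
  (forall A, measurable A -> distribution P V1 A = sphere_uniform A) ->
  (forall A, measurable A -> distribution P V2 A = sphere_uniform A) ->
  has_density lebesgue_measure (distribution P tau1)
    (rescaled_beta_pdf t a1 b1) ->
  mutually_independent P
    [tuple sigma_of V1; sigma_of V2; sigma_of tau1; sigma_of N] ->
  (0 < P [set w | N w = 1%N])%E ->
  (forall w, N w = 1%N ->
    X w = [tuple c * (tnth (V1 w) i * tau1 w + tnth (V2 w) i * (t - tau1 w))
          | i < d]) ->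
  has_density (lebesgue_tuple R d)
    (conditional_distribution X [set w | N w = 1%N])
    (fun x => if x \in eucl_ball (c * t) then p1 c t a1 b1 x else 0).

Proof.
case: d V1 V2 X => [|[|n]]// V1 V2 X _ t0 c0 a0 b0 V1u V2u tau_density indep N1 Xpos.
have [v Vv _] := ball_volume R n.+1; have [w Vw _] := ball_volume R n.
have mbeta : measurable_fun setT (rescaled_beta_pdf t a1 b1) by case: tau_density.
have mpos := @measurable_position R n t c.
(* The unconditional law of [position], under the product of the laws of V1, V2 and tau1; it is to
   be identified with the conditional law of X. *)
pose K A := ((distribution P V1 \x product_subprobability
  (distribution P V2 : subprobability _ _, distribution P tau1 : subprobability _ _))
  (position t c @^-1` A))%E.
have KE A : measurable A ->
    K A = (\int[lebesgue_tuple R n.+2]_(x in A) law_density t c a1 b1 n v w (eucl_norm x))%E.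
  by move=> mA; apply: position_law.
have mpre (A : set (n.+2.-tuple R)) : measurable A -> measurable (position t c @^-1` A).
  by move=> mA; rewrite -[X in measurable X]setTI; exact: mpos.
have XE z : N z = 1%N -> X z = position t c (V1 z, (V2 z, tau1 z)).
  by move=> Nz; rewrite Xpos//; apply: eq_from_tnth => i; rewrite !tnth_mktuple/=; ring.
pose B := [set w | N w = 1%N].
(* On [B] the variable X is [position] of the three others, so the event is one about (V1, V2, tau1)
   intersected with an event about N, and independence applies. *)
have joint A : measurable A -> P (X @^-1` A `&` B) = (P B * K A)%E.
  move=> mA; rewrite -(independent_joint_law indep (mpre _ mA) (A4 := [set 1%N]))//.
  congr (P _); apply/seteqP; split => z /= [Az Nz]; split=> //;
    by move: Az; rewrite XE.
have mB : measurable B.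
  by rewrite -[B]setTI; exact: (@measurable_funP _ _ _ _ _ N measurableT [set 1%N]).
have PB : P B = (fine (P B))%:E by rewrite fineK// fin_num_measure.
have fPB : (0 < fine (P B)) by rewrite -lte_fin -PB.
have K0 A : (0 <= K A)%E by exact: measure_ge0.
have K1 A : measurable A -> K A \is a fin_num.
  move=> mA; apply: (fin_num_measure (product_subprobability
    (distribution P V1 : subprobability _ _, product_subprobability
      (distribution P V2 : subprobability _ _, distribution P tau1 : subprobability _ _)))).
  exact: mpre.
split.
- exact: measurable_position_pdf.
- move=> x; exact: (@position_pdf_ge0 R n t c a1 b1).
(* The total integral of [law_density] is [K] of the whole space, hence finite, which is what the
   passage to the real density requires. *)
- move=> A mA; rewrite -[RHS](@integral_law_density _ _ _ _ _ _ v w)//; last first.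
    by rewrite -KE// ltey_eq K1.
  rewrite -KE// /conditional_distribution joint// PB -(fineK (K1 A mA)) -EFinM /=.
  by rewrite mulrC mulKf// gt_eqF.
Qed.
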